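(* Let $B$ be the unit ball of $\mathbb R^3$, $z\in\mathbb R^3$, $a>0$, $D=z+aB$ (a ball of radius $a$), and $c_1>0$. Let $\lambda_1>\lambda_2>\cdots$ be the eigenvalues of the Newtonian operator $N$ on $L^2(D)$ whose eigenspace contains a function $e$ with $\int_D e(y)\,dy\neq0$, listed without repetition in decreasing order, and set $\omega_n=c_1/\sqrt{\lambda_n}$ and $b=c_1\pi/a$. Then the family $\{\sin(\omega_n t),\cos(\omega_n t)\}_{n\in\mathbb N}$ is a Riesz basis of $L^2[-\pi/b,\pi/b]$.
   Context: The Newtonian operator $N:L^2(D)\to L^2(D)$ is $N(f)(x)=\int_D\frac{f(y)}{4\pi|x-y|}\,dy$. A sequence $\{p_n\}$ in a Hilbert space $\mathcal H$ is a Riesz basis if it is the image of an orthonormal basis under a bounded invertible linear operator on $\mathcal H$; equivalently, it is complete and there exist constants $0<\mathcal A\le\mathcal B$ with $\mathcal A\sum|c_n|^2\le\|\sum c_np_n\|^2\le\mathcal B\sum|c_n|^2$ for all finite scalar sequences $(c_n)$. *)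

(* Defs.v *)
From HB Require Import structures.
From mathcomp Require Import all_boot all_order all_algebra.
From mathcomp Require Import all_classical all_reals all_analysis.
Set Implicit Arguments. Unset Strict Implicit. Unset Printing Implicit Defensive.
Import Order.TTheory GRing.Theory Num.Theory.
Import numFieldNormedType.Exports.
Local Open Scope classical_set_scope.
Local Open Scope ring_scope.

Definition R3 (R : realType) := ((R * R) * R)%type.

Definition leb3 (R : realType) :=
  ((@lebesgue_measure R \x @lebesgue_measure R) \x @lebesgue_measure R)%E.

Definition dist3 (R : realType) (x y : R3 R) : R :=
  Num.sqrt ((x.1.1 - y.1.1) ^+ 2 + (x.1.2 - y.1.2) ^+ 2 + (x.2 - y.2) ^+ 2).

Definition ball3 (R : realType) (z : R3 R) (a : R) : set (R3 R) :=
  [set y | dist3 z y < a].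

Definition L2on {d} {T : measurableType d} {R : realType}
  (mu : set T -> \bar R) (D : set T) (f : T -> R) : Prop :=
  measurable_fun D f /\ (\int[mu]_(x in D) ((f x) ^+ 2)%:E < +oo)%E.

Definition newtonian (R : realType) (D : set (R3 R)) (f : R3 R -> R)
  (x : R3 R) : R :=
  Rintegral (@leb3 R) D (fun y => f y / (4 * pi * dist3 x y)).

Definition mean_eigenvalue (R : realType) (D : set (R3 R)) (lam : R) : Prop :=
  exists e : R3 R -> R,
    [/\ L2on (@leb3 R) D e,
        {ae @leb3 R, forall x, D x -> newtonian D e x = lam * e x}
      & Rintegral (@leb3 R) D e != 0].

Definition sqnormI (R : realType) (l r : R) (f : R -> R) : \bar R :=
  (\int[@lebesgue_measure R]_(t in `[l, r]) ((f t) ^+ 2)%:E)%E.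

(* The family {sin(w_n t), cos(w_n t)}_n is a Riesz basis of L^2[l, r]
   (real scalars): it is complete, and there are 0 < A <= B with
   A sum |c|^2 <= ||sum c p||^2 <= B sum |c|^2 for finitely supported
   coefficients (every finite support lies in an initial segment {n < M}). *)
Definition sincos_comb (R : realType) (w : nat -> R) (M : nat)
  (c d : nat -> R) (t : R) : R :=
  \sum_(n < M) (c n * sin (w n * t) + d n * cos (w n * t)).

Definition sincos_riesz_basis (R : realType) (w : nat -> R) (l r : R) : Prop :=
  (forall f : R -> R, L2on (@lebesgue_measure R) `[l, r] f ->
     forall eps : R, 0 < eps -> exists M c d,
       (sqnormI l r (fun t => (f t - sincos_comb w M c d t)%R) < eps%:E)%E)
  /\
  exists A B : R, [/\ 0 < A, A <= B &
    forall (M : nat) (c d : nat -> R),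
      let s := \sum_(n < M) (c n ^+ 2 + d n ^+ 2) in
      ((A * s)%:E <= sqnormI l r (sincos_comb w M c d))%E /\
      (sqnormI l r (sincos_comb w M c d) <= (B * s)%:E)%E].

(* Main.v *)
(* By the shell theorem, on the ball of radius [a] the function
   [g_k = sin (k r) / r] satisfies [N g_k = g_k / k ^ 2 - cos (k a) / k].  Hence
   [k ^ -2] is an eigenvalue with an eigenfunction of nonzero mean when
   [cos (k a) = 0].  Conversely, if [N e = k ^ -2 e], then pairing with [g_k] and
   using the symmetry of the kernel gives [cos (k a) / k * \int e = 0].  The
   listed eigenvalues are thus [(a / ((n + 1/2) pi)) ^ 2], nonpositive ones being
   excluded because the list is decreasing and already has to enumerate these.

   The shell theorem is proved by rotating the pole onto an axis; rotations
   preserve the measure because they are products of shears.  On the axis, polar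
   coordinates in the orthogonal plane and the substitution [w = |y| ^ 2] reduce
   the integral to the fundamental theorem of calculus.

   The frequencies are therefore [(n + 1/2) pi / L] on [[- L, L]], for which the
   sines and cosines are orthogonal of squared norm [L].  For completeness,
   iterating [y |-> (3 y - y ^ 3) / 2] on [sin (pi (t - c) / (2 L))] yields sums
   with these frequencies that converge boundedly to the sign of [t - c], hence
   all indicator functions, by a lambda-system argument, and all of L^2 by
   dominated convergence. *)
Require Import Defs.
From HB Require Import structures.
From mathcomp Require Import finmap.
From mathcomp Require Import all_boot all_order all_algebra ring lra.
From mathcomp Require Import all_classical all_reals all_analysis measurable_realfun.
Set Implicit Arguments. Unset Strict Implicit. Unset Printing Implicit Defensive.
Import Order.TTheory GRing.Theory Num.Theory.
Import numFieldNormedType.Exports.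
Local Open Scope classical_set_scope.
Local Open Scope ring_scope.

(** * Rotation invariance of Lebesgue measure on R^3 *)

Section preserving.
Context {R : realType}.
Local Notation mu := (@lebesgue_measure R).
Local Notation RT := (measurableTypeR R).

(** An arbitrary L^2 eigenfunction enters only through one pairing with an explicit radial function.
    What makes Fubini available for it is a single estimate: the potential of the ball is bounded
    off the centre. Radial functions are written in the squared distance [w]. The disk of squared
    radius [u] has area [pi * u], linear in [u], so planar Lebesgue measure pushes forward to a
    constant multiple of Lebesgue measure on the half-line. Two default values shape the statements.
    Division by 0 gives 0, so the potential formulas are stated off the centre of the ball, a null
    set. [Rintegral] goes through [fine], so integrability must be known before the eigenvalue
    equation can be read as an equation between integrals. On the trigonometric side the constants
    are not finite combinations of the family, but multiplication by [cos (pi / L * t + g)] maps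
    combinations to combinations. This is why odd polynomials in a sine of the lowest frequency are
    used, and why the constant 1 is itself obtained as a limit of signs. *)

Lemma lebesgue_measure_shift (c : R) (A : set R) : measurable A ->
  pushforward mu (fun x : R => x + c) A = mu A.
Proof.
move=> mA; symmetry.
have mf : measurable_fun [set: measurableTypeR R]
    (fun x : R => x + c : measurableTypeR R) by exact: measurable_funD.
pose f : {mfun (measurableTypeR R) >-> (measurableTypeR R)} :=
  HB.pack (fun x : R => x + c) (isMeasurableFun.Build _ _ _ _ _ mf).
apply: (@lebesgue_measure_unique R (pushforward mu f)) => // _ [[l r] /= _ <-].
rewrite /pushforward [X in mu X = _](_ : _ = [set` Interval (BRight l) (BRight r)])//.
rewrite (_ : _ @^-1` _ = [set` Interval (BRight (l - c)) (BRight (r - c))]); last first.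
  by apply/seteqP; split=> x /=; rewrite !in_itv/= ltrBlDr lerBrDr.
rewrite !lebesgue_measure_itv/= !lte_fin ltrD2r.
by case: ifPn => // _; rewrite -!EFinD; congr EFin; ring.
Qed.

End preserving.

(** * Measure-preserving maps on products *)

Section measure_preserving.
Local Open Scope ereal_scope.
Context {R : realType}.

(** Invariance is stated for integrals of nonnegative functions rather than for measures of sets, so
    that Tonelli transfers it from slices to products at once. *)
Definition preserving d (T : measurableType d) (m : set T -> \bar R)
    (g : T -> T) :=
  measurable_fun setT g /\ forall f : T -> \bar R, measurable_fun setT f ->
    (forall x, 0 <= f x) -> \int[m]_x f (g x) = \int[m]_x f x.

Lemma preserving_comp d (T : measurableType d) (m : set T -> \bar R) g1 g2 :
  preserving m g1 -> preserving m g2 -> preserving m (g1 \o g2).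
Proof.
move=> [m1 p1] [m2 p2]; split; first exact: measurableT_comp.
move=> f mf f0; rewrite -(p1 f)//; apply: (p2 (f \o g1)).
  exact: measurableT_comp.
by move=> x; exact: f0.
Qed.

Lemma preserving_shift (c : R) :
  preserving (@lebesgue_measure R)
    (fun x => x + c : measurableTypeR R)%R.
Proof.
have mF : measurable_fun [set: measurableTypeR R]
    (fun x : R => x + c : measurableTypeR R)%R.
  exact: measurable_funD.
split=> // f mf f0.
rewrite -[LHS](@ge0_integral_pushforward _ _ _ _ _ _ mF
  (@lebesgue_measure R) setT f)//.
by apply: eq_measure_integral => A mA _; exact: lebesgue_measure_shift.
Qed.

Context d1 d2 (T1 : measurableType d1) (T2 : measurableType d2).
Variable m1 : {sigma_finite_measure set T1 -> \bar R}.
Variable m2 : {sigma_finite_measure set T2 -> \bar R}.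

(** Tonelli with the second coordinate innermost: for fixed [x] the map acts on the slice by
    [g x]. *)
Lemma preserving_prodr (g : T1 -> T2 -> T2) :
  measurable_fun setT (fun p => g p.1 p.2) ->
  (forall x, preserving m2 (g x)) ->
  preserving (m1 \x m2) (fun p => (p.1, g p.1 p.2)).
Proof.
move=> mg pg.
have mG : measurable_fun setT (fun p : T1 * T2 => (p.1, g p.1 p.2)).
  exact: measurable_fun_pair.
split=> // f mf f0.
rewrite (fubini_tonelli1 f)//.
rewrite (fubini_tonelli1 (fun p => f (p.1, g p.1 p.2)))//; last first.
  exact: (measurableT_comp mf mG).
apply: eq_integral => x _; rewrite /fubini_F/=.
apply: (pg x).2 => //.
exact: (measurableT_comp mf).
Qed.

Lemma preserving_prodl (g : T1 -> T2 -> T1) :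
  measurable_fun setT (fun p => g p.1 p.2) ->
  (forall y, preserving m1 (g ^~ y)) ->
  preserving (m1 \x m2) (fun p => (g p.1 p.2, p.2)).
Proof.
move=> mg pg.
have mG : measurable_fun setT (fun p : T1 * T2 => (g p.1 p.2, p.2)).
  exact: measurable_fun_pair.
split=> // f mf f0.
rewrite (fubini_tonelli2 f)//.
rewrite (fubini_tonelli2 (fun p => f (g p.1 p.2, p.2)))//; last first.
  exact: (measurableT_comp mf mG).
apply: eq_integral => y _; rewrite /fubini_G/=.
apply: (pg y).2 (fun x => f (x, y)) _ _ => //.
exact: (measurableT_comp mf).
Qed.

End measure_preserving.

(** * Sigma-finiteness of product measures *)

Section product_sigma_finite.
Local Open Scope ereal_scope.
Context d1 d2 (T1 : measurableType d1) (T2 : measurableType d2) (R : realType).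
Variable m1 : {sigma_finite_measure set T1 -> \bar R}.
Variable m2 : {sigma_finite_measure set T2 -> \bar R}.

Lemma sigma_finite_product : sigma_finite setT (m1 \x m2).
Proof.
have /sigma_finiteP[F [TF ndF Foo]] := sigma_finiteT m1.
have /sigma_finiteP[G [TG ndG Goo]] := sigma_finiteT m2.
exists (fun n => F n `*` G n) => [|k].
  apply/seteqP; split=> [[x y] _|//].
  have [n _ Fx] : (\bigcup_n F n) x by rewrite -TF.
  have [k _ Gy] : (\bigcup_n G n) y by rewrite -TG.
  exists (n + k)%N => //; split=> /=.
    by apply: (subsetPset _ _ (ndF _ _ _)) Fx; rewrite leq_addr.
  by apply: (subsetPset _ _ (ndG _ _ _)) Gy; rewrite leq_addl.
have [mF Fk] := Foo k; have [mG Gk] := Goo k; split; first exact: measurableX.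
by rewrite product_measure1E// lte_mul_pinfty// ge0_fin_numE.
Qed.

Definition product_sf : {sigma_finite_measure set (T1 * T2)%type -> \bar R} :=
  HB.pack (m1 \x m2) (Measure_isSigmaFinite.Build _ _ _ (m1 \x m2)
    sigma_finite_product).

End product_sigma_finite.

(* The inferred structure on a product of measures is only sigma-finite for
   subprobabilities, whence the explicit packing. *)
Definition sf_leb2 (R : realType) :=
  product_sf (@lebesgue_measure R) (@lebesgue_measure R).

Definition sf_leb3 (R : realType) :=
  product_sf (sf_leb2 R) (@lebesgue_measure R).

(** * Shears, translations and rotations of space *)

Section rotation.
Context {R : realType}.
Local Notation mu := (@lebesgue_measure R).
Local Notation RT := (measurableTypeR R).
Local Notation RT3 := (RT * RT * RT)%type.
Local Notation leb := (sf_leb3 R).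

(** With the other two coordinates frozen, a shear is a translation of the line. *)
Lemma preserving_shear1 (h : RT * RT -> RT) : measurable_fun setT h ->
  preserving leb
    (fun x : RT3 => (x.1.1 + h (x.1.2, x.2) : RT, x.1.2, x.2)).
Proof.
move=> mh.
apply: (@preserving_prodl _ _ _ _ _ (sf_leb2 R) mu
  (fun p x3 => (p.1 + h (p.2, x3) : RT, p.2))).
  apply: measurable_fun_pair; last exact: measurableT_comp.
  apply: measurable_funD; first exact: measurableT_comp.
  apply: (measurableT_comp mh); apply: measurable_fun_pair => //.
  exact: measurableT_comp.
move=> x3.
apply: (@preserving_prodl _ _ _ _ _ mu mu (fun x1 x2 => x1 + h (x2, x3) : RT)).
  apply: measurable_funD => //.
  by apply: (measurableT_comp mh); apply: measurable_fun_pair.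
by move=> x2; exact: preserving_shift.
Qed.

Lemma preserving_shear2 (h : RT * RT -> RT) : measurable_fun setT h ->
  preserving leb
    (fun x : RT3 => (x.1.1, x.1.2 + h (x.1.1, x.2) : RT, x.2)).
Proof.
move=> mh.
apply: (@preserving_prodl _ _ _ _ _ (sf_leb2 R) mu
  (fun p x3 => (p.1, p.2 + h (p.1, x3) : RT))).
  apply: measurable_fun_pair; first exact: measurableT_comp.
  apply: measurable_funD; first exact: measurableT_comp.
  apply: (measurableT_comp mh); apply: measurable_fun_pair => //.
  exact: measurableT_comp.
move=> x3.
apply: (@preserving_prodr _ _ _ _ _ mu mu (fun x1 x2 => x2 + h (x1, x3) : RT)).
  apply: measurable_funD => //.
  by apply: (measurableT_comp mh); apply: measurable_fun_pair.
by move=> x2; exact: preserving_shift.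
Qed.

Lemma preserving_shear3 (h : RT * RT -> RT) : measurable_fun setT h ->
  preserving leb (fun x : RT3 => (x.1, x.2 + h x.1 : RT)).
Proof.
move=> mh.
apply: (@preserving_prodr _ _ _ _ _ (sf_leb2 R) mu
  (fun p x3 => x3 + h p : RT)).
  by apply: measurable_funD => //; exact: measurableT_comp.
by move=> p; exact: preserving_shift.
Qed.

Lemma preserving_translation (z : RT3) : preserving leb
  (fun x : RT3 => (x.1.1 + z.1.1 : RT, x.1.2 + z.1.2 : RT, x.2 + z.2 : RT)).
Proof.
exact: (preserving_comp
  (@preserving_shear3 (cst (z.2 : RT)) (measurable_cst _))
  (preserving_comp
    (@preserving_shear2 (cst (z.1.2 : RT)) (measurable_cst _))
    (@preserving_shear1 (cst (z.1.1 : RT)) (measurable_cst _)))).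
Qed.

(* A plane rotation with cosine [c] and sine [s <> 0] is a product of three
   shears, of slopes [(c - 1) / s], [s] and [(c - 1) / s]. *)
Lemma preserving_rot1 (c s : R) : s != 0 -> c ^+ 2 + s ^+ 2 = 1 ->
  preserving leb
    (fun x : RT3 => (c * x.1.1 - s * x.2 : RT, x.1.2, s * x.1.1 + c * x.2 : RT)).
Proof.
move=> s0 cs; pose t := (c - 1) / s.
have m1 : measurable_fun setT (fun p : RT * RT => t * p.2 : RT).
  exact: measurable_funM.
have m2 : measurable_fun setT (fun p : RT * RT => s * p.1 : RT).
  exact: measurable_funM.
have := preserving_comp (preserving_shear1 m1)
  (preserving_comp (preserving_shear3 m2)
     (preserving_shear1 m1)).
congr preserving; apply/funext => -[[x1 x2] x3] /=.
have e1 : t * s = c - 1 by rewrite /t mulfVK.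
have e2 : t * (1 + c) = - s.
  apply: (mulIf s0); rewrite -mulrA (mulrC (1 + c)) mulrA e1.
  transitivity (- (1 - c ^+ 2)); first by ring.
  by rewrite -cs; ring.
congr (_, _, _).
- transitivity (x1 + t * s * x1 + t * (1 + (t * s + 1)) * x3); first by ring.
  by rewrite e1 subrK e2; ring.
- transitivity (s * x1 + (1 + t * s) * x3); first by ring.
  by rewrite e1; ring.
Qed.

Lemma preserving_rot2 (c s : R) : s != 0 -> c ^+ 2 + s ^+ 2 = 1 ->
  preserving leb
    (fun x : RT3 => (x.1.1, c * x.1.2 - s * x.2 : RT, s * x.1.2 + c * x.2 : RT)).
Proof.
move=> s0 cs; pose t := (c - 1) / s.
have m1 : measurable_fun setT (fun p : RT * RT => t * p.2 : RT).
  exact: measurable_funM.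
have m2 : measurable_fun setT (fun p : RT * RT => s * p.2 : RT).
  exact: measurable_funM.
have := preserving_comp (preserving_shear2 m1)
  (preserving_comp (preserving_shear3 m2)
     (preserving_shear2 m1)).
congr preserving; apply/funext => -[[x1 x2] x3] /=.
have e1 : t * s = c - 1 by rewrite /t mulfVK.
have e2 : t * (1 + c) = - s.
  apply: (mulIf s0); rewrite -mulrA (mulrC (1 + c)) mulrA e1.
  transitivity (- (1 - c ^+ 2)); first by ring.
  by rewrite -cs; ring.
congr (_, _, _).
- transitivity (x2 + t * s * x2 + t * (1 + (t * s + 1)) * x3); first by ring.
  by rewrite e1 subrK e2; ring.
- transitivity (s * x2 + (1 + t * s) * x3); first by ring.
  by rewrite e1; ring.
Qed.

Definition sqn3 (x : RT3) := x.1.1 ^+ 2 + x.1.2 ^+ 2 + x.2 ^+ 2.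
Definition sqd3 (x y : RT3) :=
  (x.1.1 - y.1.1) ^+ 2 + (x.1.2 - y.1.2) ^+ 2 + (x.2 - y.2) ^+ 2.

(** Two plane rotations annihilate the first and then the second coordinate of [x]. The
    factorization into shears divides by the sine, so a coordinate that already vanishes is treated
    separately. No sign of [r] is claimed: when both vanish, [r] is the third coordinate itself. *)
Lemma rotation_to_axis (x : RT3) : exists2 T, preserving leb T &
  exists r : R, forall y,
    sqn3 (T y) = sqn3 y /\ sqd3 (T y) (0, 0, r) = sqd3 y x.
Proof.
have rotcs (p q : R) : p != 0 -> let r := Num.sqrt (p ^+ 2 + q ^+ 2) in
    [/\ p / r != 0, (q / r) ^+ 2 + (p / r) ^+ 2 = 1 &
      r = p * (p / r) + q * (q / r) /\ (q / r) * p - (p / r) * q = 0].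
  move=> p0 r; have pq : 0 < p ^+ 2 + q ^+ 2.
    by rewrite ltr_pwDl ?sqr_ge0// exprn_even_gt0.
  have r0 : r != 0 by rewrite sqrtr_eq0 -ltNge.
  have r2 : p ^+ 2 + q ^+ 2 = r ^+ 2 by rewrite sqr_sqrtr// ltW.
  split; first by rewrite mulf_neq0// invr_eq0.
    rewrite !expr_div_n addrC -mulrDl r2 divff//.
    by rewrite expf_neq0.
  split; last by field.
  transitivity ((p ^+ 2 + q ^+ 2) / r); last by field.
  by rewrite r2; field.
(* The first rotation acts in the plane of the first and third coordinates and takes [x] to a point
   with first coordinate 0. *)
have [T1 pT1 [x2 [x3 H1]]] : exists2 T, preserving leb T &
  exists x2 x3 : R, forall y,
    sqn3 (T y) = sqn3 y /\ sqd3 (T y) (0, x2, x3) = sqd3 y x.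
  have [x10|x10] := eqVneq x.1.1 0.
    exists idfun; first by split=> //; exact: measurable_id.
    by exists x.1.2, x.2 => y; split=> //; rewrite /sqd3/= x10.
  have [s0 cs [rE e0]] := rotcs x.1.1 x.2 x10.
  refine (ex_intro2 _ _ _ (preserving_rot1 s0 cs) _).
  exists x.1.2, (Num.sqrt (x.1.1 ^+ 2 + x.2 ^+ 2)) => y.
  move: e0 rE cs; set r := Num.sqrt _.
  set s := x.1.1 / r; set c := x.2 / r => e0 rE cs.
  rewrite /sqn3 /sqd3 /=; split.
    transitivity ((c ^+ 2 + s ^+ 2) * (y.1.1 ^+ 2 + y.2 ^+ 2) + y.1.2 ^+ 2).
      by ring.
    by rewrite cs; ring.
  rewrite rE -e0.
  transitivity ((c ^+ 2 + s ^+ 2) * ((y.1.1 - x.1.1) ^+ 2 + (y.2 - x.2) ^+ 2) +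
    (y.1.2 - x.1.2) ^+ 2); first by ring.
  by rewrite cs; ring.
have [x20|x20] := eqVneq x2 0.
  by exists T1 => //; exists x3 => y; have := H1 y; rewrite x20.
have [s0 cs [rE e0]] := rotcs x2 x3 x20.
refine (ex_intro2 _ _ _ (preserving_comp (preserving_rot2 s0 cs) pT1) _).
exists (Num.sqrt (x2 ^+ 2 + x3 ^+ 2)) => y.
have [<- <-] := H1 y; rewrite /comp; move: (T1 y) => {H1} {}y.
move: e0 rE cs; set r := Num.sqrt _.
set s := x2 / r; set c := x3 / r => e0 rE cs.
rewrite /sqn3 /sqd3 /=; split.
  transitivity ((c ^+ 2 + s ^+ 2) * (y.1.2 ^+ 2 + y.2 ^+ 2) + y.1.1 ^+ 2).
    by ring.
  by rewrite cs; ring.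
rewrite rE -{2}e0.
transitivity ((c ^+ 2 + s ^+ 2) * ((y.1.2 - x2) ^+ 2 + (y.2 - x3) ^+ 2) +
  (y.1.1 - 0) ^+ 2); first by ring.
by rewrite cs; ring.
Qed.

End rotation.

(** * Radial integrals and the shell theorem *)

Section calculus.
Context {R : realType}.
Local Notation mu := (@lebesgue_measure R).

(** The derivative is asked only in the open interval because antiderivatives built from [Num.sqrt]
    are used on intervals starting at 0; degenerate intervals also occur, for a sphere of radius
    0. *)
Lemma integral_FTC (f F : R -> R) (a b : R) : a <= b ->
  {in `[a, b], continuous f} -> {in `[a, b], continuous F} ->
  (forall x, a < x < b -> is_derive x (1 : R) F (f x)) ->
  (\int[mu]_(x in `[a, b]) (f x)%:E = (F b - F a)%:E)%E.
Proof.
rewrite le_eqVlt => /predU1P[<- _ _ _|ab cf cF dF].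
  by rewrite set_itv1 integral_set1 subrr.
rewrite (@continuous_FTC2 R f F)//.
- apply: continuous_in_subspaceT => x /set_mem xab; exact: cf.
- split.
  + by move=> x; rewrite in_itv/= => /dF[].
  + apply: cvg_at_right_filter; apply: cF; by rewrite in_itv/= lexx ltW.
  + apply: cvg_at_left_filter; apply: cF; by rewrite in_itv/= lexx ltW.
- by move=> x; rewrite in_itv/= derive1E => /dF[_ ->].
Qed.

(** The substitution [x = sqrt u * sin th] turns the chord lengths of the disk into
    [2 * u * cos th ^+ 2], with antiderivative [u * (th + sin th * cos th)]. *)
Lemma integral_semidisk (u : R) : 0 < u ->
  (\int[mu]_(x in `[(- Num.sqrt u)%R, Num.sqrt u])
     (2 * Num.sqrt (u - x ^+ 2))%:E = (u * pi)%:E)%E.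
Proof.
move=> u0; have s0 : 0 < Num.sqrt u by rewrite sqrtr_gt0.
have pi20 : 0 < pi / 2 :> R by rewrite divr_gt0// pi_gt0.
pose F (x : R) : R := Num.sqrt u * sin x.
have dF (x : R) : is_derive x (1 : R) F (Num.sqrt u * cos x).
  by apply: is_derive_eq; rewrite /GRing.scale/=; ring.
have F' : derive1 F = (fun x => Num.sqrt u * cos x).
  by apply/funext => x; rewrite derive1E; have [_ ->] := dF x.
have cF : continuous F.
  by move=> x; apply: cvgM; [exact: cvg_cst|exact: continuous_sin].
have cF' : continuous (fun x : R => Num.sqrt u * cos x).
  by move=> x; apply: cvgM; [exact: cvg_cst|exact: continuous_cos].
have <- : F (- (pi / 2)) = - Num.sqrt u by rewrite /F sinN sin_pihalf mulrN1.
have <- : F (pi / 2) = Num.sqrt u by rewrite /F sin_pihalf mulr1.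
rewrite integration_by_substitution_increasing//.
- rewrite F'.
  transitivity (\int[mu]_(x in `[(- (pi / 2))%R, (pi / 2)%R])
      (2 * u * cos x ^+ 2)%:E)%E.
    apply: eq_integral => x /set_mem/=; rewrite in_itv/= => xpi; congr EFin.
    change (2 * Num.sqrt (u - F x ^+ 2) * (Num.sqrt u * cos x) =
      2 * u * cos x ^+ 2).
    have -> : u - F x ^+ 2 = u * cos x ^+ 2.
      by rewrite /F exprMn sqr_sqrtr ?(ltW u0)// cos2sin2; ring.
    rewrite sqrtrM ?(ltW u0)// sqrtr_sqr ger0_norm ?cos_ge0_pihalf//.
    by rewrite -[in RHS](sqr_sqrtr (ltW u0)); ring.
  transitivity ((u * (pi / 2 + sin (pi / 2) * cos (pi / 2)) -
      u * (- (pi / 2) + sin (- (pi / 2)) * cos (- (pi / 2))))%:E).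
    apply: (@integral_FTC _ (fun x => u * (x + sin x * cos x))).
    - lra.
    - move=> x _; apply: cvgM; first exact: cvg_cst.
      by apply: (@continuous_comp _ _ _ cos (fun y : R => y ^+ 2));
        [exact: continuous_cos|exact: exprn_continuous].
    - move=> x _; apply: cvgM; first exact: cvg_cst.
      apply: cvgD; first exact: cvg_id.
      by apply: cvgM; [exact: continuous_sin|exact: continuous_cos].
    - move=> x _; apply: is_derive_eq; rewrite /GRing.scale/=.
      by transitivity (u * (1 - sin x ^+ 2 + cos x ^+ 2));
        [ring|rewrite -cos2sin2; ring].
  by rewrite sinN cosN cos_pihalf !mulr0 !addr0; congr EFin; field.
- lra.
- by move=> x y xI yI xy; rewrite /F ltr_pM2l// ltr_sin.
- by rewrite F' => x _; exact: cF'.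
- by rewrite F'; apply/cvg_ex; eexists; apply: cvg_at_right_filter; exact: cF'.
- by rewrite F'; apply/cvg_ex; eexists; apply: cvg_at_left_filter; exact: cF'.
- split; first by move=> x _; have [] := dF x.
  + by apply: cvg_at_right_filter; exact: cF.
  + by apply: cvg_at_left_filter; exact: cF.
- apply: continuous_subspaceT => x.
  apply: cvgM; first exact: cvg_cst.
  apply: continuous_comp; last exact: sqrt_continuous.
  by apply: cvgB; [exact: cvg_cst|exact: exprn_continuous].
Qed.

End calculus.

(** * Radial integrals in the plane *)

Section radial2.
Context {R : realType}.
Local Notation mu := (@lebesgue_measure R).
Local Notation RT := (measurableTypeR R).

Definition sq2 (p : RT * RT) : RT := p.1 ^+ 2 + p.2 ^+ 2.

Lemma measurable_sq2 : measurable_fun setT sq2.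
Proof.
by apply: measurable_funD; apply: measurable_funX.
Qed.

Lemma lebesgue_measure_sym_itv (s : R) :
  mu `](- s), s[ = (2 * Num.max s 0)%:E.
Proof.
rewrite lebesgue_measure_itv/= lte_fin.
have [ss|ss] := ltP (- s) s; have [s0|s0] := leP s 0.
- by exfalso; lra.
- by rewrite -EFinD; congr EFin; ring.
- by rewrite mulr0.
- by exfalso; lra.
Qed.

Lemma disk_area (u : R) : sf_leb2 R (sq2 @^-1` `]-oo, u[) = (pi * Num.max u 0)%:E.
Proof.
pose A := sq2 @^-1` `]-oo, u[.
change ((\int[mu]_x mu (xsection A x))%E = (pi * Num.max u 0)%:E).
(* [Num.sqrt] vanishes on negative numbers, so the formula also gives the empty slices with
   [u <= x ^+ 2]. *)
have AE (x : R) : xsection A x = `](- Num.sqrt (u - x ^+ 2)), Num.sqrt (u - x ^+ 2)[%classic.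
  apply/seteqP; split=> y /=; rewrite /xsection/= in_itv/=.
    move=> /set_mem; rewrite /A/= in_itv/= /sq2/= => H.
    rewrite -ltr_norml -sqrtr_sqr ltr_sqrt//; first by rewrite ltrBrDl.
    by rewrite subr_gt0; apply: le_lt_trans H; rewrite lerDl sqr_ge0.
  rewrite -ltr_norml -sqrtr_sqr => H; apply/mem_set; rewrite /A/= in_itv/= /sq2/=.
  have u0 : 0 < u - x ^+ 2.
    by rewrite -sqrtr_gt0; apply: le_lt_trans H; exact: sqrtr_ge0.
  by rewrite -ltrBrDl -ltr_sqrt.
transitivity (\int[mu]_x (2 * Num.sqrt (u - x ^+ 2))%:E)%E.
  apply: eq_integral => x _; rewrite AE lebesgue_measure_sym_itv.
  by rewrite max_l// sqrtr_ge0.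
have [u0|u0] := leP u 0.
  rewrite mulr0 integral0_eq// => x _; congr EFin.
  rewrite ler0_sqrtr ?mulr0// subr_le0.
  by apply: le_trans u0 _; exact: sqr_ge0.
rewrite mulrC -integral_semidisk// [RHS]integral_mkcond.
apply: eq_integral => x _; rewrite patchE; case: ifPn => // /negP xu.
congr EFin; rewrite ler0_sqrtr ?mulr0// subr_le0 leNgt; apply/negP => xu'.
apply: xu; apply/mem_set; rewrite /= in_itv/= -ler_norml -sqrtr_sqr.
by rewrite ler_sqrt ?ltW.
Qed.

(** By [disk_area] both measures agree, with finite values, on the rays []-oo, u[], an
    intersection-stable family generating the Borel sets. The comparison measure is Lebesgue measure
    restricted to the half-line, where [sq2] takes its values. *)
Lemma pushforward_sq2 (A : set RT) : measurable A -> A `<=` `[0, +oo[ ->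
  pushforward (sf_leb2 R) sq2 A = (pi%:E * mu A)%E.
Proof.
move=> mA A0.
have mI : measurable (`[0, +oo[%classic : set RT) by exact: measurable_itv.
pose q : {mfun (RT * RT)%type >-> RT} :=
  HB.pack sq2 (isMeasurableFun.Build _ _ _ _ _ measurable_sq2).
have pi0 : 0 <= pi :> R := pi_ge0 R.
transitivity (mscale (NngNum pi0) (mrestr mu mI) A); last first.
  by rewrite /mscale/= /mrestr setIidl.
apply: (@measure_unique _ R RT (@RGenInftyO.G R) (fun n => `]-oo, n%:R[%classic)
  _ _ _ _ (pushforward (sf_leb2 R) q)) => //.
- exact: RGenInftyO.measurableE.
- move=> _ _ [x ->] [y ->]; exists (Num.min x y).
  by apply/seteqP; split=> t /=; rewrite !in_itv/= lt_min => /andP.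
- by move=> n; exists n%:R.
- apply/seteqP; split=> // x _; exists (Num.trunc `|x|).+1 => //=.
  rewrite in_itv/=; apply: le_lt_trans (ler_norm x) _.
  exact: truncnS_gt.
- move=> _ [x ->]; rewrite [LHS]disk_area /mscale/= /mrestr.
  rewrite EFinM; congr (_ * _)%E.
  change ((Num.max x 0)%:E = mu (`]-oo, x[ `&` `[0, +oo[)).
  have [x0|x0] := leP x 0.
    rewrite (_ : _ `&` _ = set0) ?measure0// -subset0 => t [] /=.
    by rewrite !in_itv/= andbT => tx t0; have := lt_le_trans tx x0; rewrite ltNge t0.
  rewrite (_ : _ `&` _ = `[0, x[%classic).
    by rewrite lebesgue_measure_itv/= lte_fin x0 oppr0 adde0.
  apply/seteqP; split=> t /=; rewrite !in_itv/= andbT.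
    by move=> [-> ->].
  by move=> /andP[-> ->].
- by move=> k; rewrite [X in (X < _)%E]disk_area ltry.
Qed.

Lemma integral_radial2 (F : RT -> \bar R) : measurable_fun setT F ->
  (forall x, (0 <= F x)%E) ->
  (\int[sf_leb2 R]_p F (sq2 p) = pi%:E * \int[mu]_(u in `[0%R, +oo[) F u)%E.
Proof.
move=> mF F0.
have mI : measurable (`[0, +oo[%classic : set RT) by exact: measurable_itv.
have mFI : measurable_fun (`[0, +oo[%classic : set RT) F.
  exact: measurable_funS mF.
have pi0 : 0 <= pi :> R := pi_ge0 R.
rewrite -[RHS](ge0_integral_mscale mu mI (NngNum pi0) mFI)//.
pose q : {mfun (RT * RT)%type >-> RT} :=
  HB.pack sq2 (isMeasurableFun.Build _ _ _ _ _ measurable_sq2).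
transitivity (\int[pushforward (sf_leb2 R) q]_(u in `[0%R, +oo[) F u)%E.
  rewrite (ge0_integral_pushforward measurable_sq2)//.
  rewrite (_ : _ @^-1` _ = setT)//; apply/seteqP; split=> // p _.
  by rewrite /= in_itv/= andbT addr_ge0// sqr_ge0.
by apply: eq_measure_integral => A mA /(pushforward_sq2 mA).
Qed.

End radial2.

(** * The potential of a sphere *)

Section shell.
Context {R : realType}.
Local Notation mu := (@lebesgue_measure R).
Local Notation RT := (measurableTypeR R).
Local Notation RT3 := (RT * RT * RT)%type.

(** The inverse is discontinuous at 0, so the function is rewritten as a real power, with which it
    agrees at 0 too. *)
Lemma measurable_invsqrt :
  measurable_fun [set: RT] (fun t : RT => (Num.sqrt (t : R))^-1 : RT).
Proof.
rewrite (_ : (fun _ => _) = fun t : RT => powR (Num.sqrt (t : R)) (- 1)).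
  apply: (measurableT_comp (measurable_powR _)).
  by apply: continuous_measurable_fun; exact: sqrt_continuous.
by apply/funext => t; rewrite powR_inv1 ?sqrtr_ge0.
Qed.

(** Up to the factor [pi], the potential for the kernel [1 / |x - y|], at distance [r] from the
    centre, of the sphere of squared radius [w], per unit of [w]. It grows like [sqrt w] while the
    sphere lies inside radius [r] and is constant beyond. *)
Definition shell (r w : R) : R := 2 * Num.min (Num.sqrt w) r / r.

Lemma shell_ge0 r w : 0 <= r -> 0 <= shell r w.
Proof. by move=> r0; rewrite /shell divr_ge0// mulr_ge0// le_min sqrtr_ge0. Qed.

Lemma measurable_shell r : measurable_fun [set: RT] (shell r : RT -> RT).
Proof.
apply: measurable_funM; last exact: measurable_cst.
apply: measurable_funM; first exact: measurable_cst.
apply: measurable_minr; last exact: measurable_cst.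
by apply: continuous_measurable_fun; exact: sqrt_continuous.
Qed.

(** The integrand is the inverse distance from the pole to the points at height [v] on the sphere of
    squared radius [w]; it has the antiderivative [- rho^-1 * sqrt (w + rho ^+ 2 - 2 * v * rho)],
    whose end values are [|s - rho|] and [|s + rho|] up to that factor. The excluded [w] is the
    sphere through the pole, where the integrand is singular at an endpoint. *)
Lemma integral_invsqrt_shell (rho w : R) : rho != 0 -> 0 <= w ->
    w != rho ^+ 2 ->
  (\int[mu]_(v in `[(- Num.sqrt w)%R, Num.sqrt w])
    ((Num.sqrt (w + rho ^+ 2 - 2 * v * rho))^-1)%:E = (shell `|rho| w)%:E)%E.
Proof.
move=> rho0 w0 wrho; set s := Num.sqrt w.
have s0 : 0 <= s by exact: sqrtr_ge0.
have s2 : s ^+ 2 = w by rewrite sqr_sqrtr.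
have pos (v : R) : - s <= v <= s -> 0 < w + rho ^+ 2 - 2 * v * rho.
  move=> vs; have sr : s != `|rho|.
    by apply: contra wrho => /eqP sr; rewrite -s2 sr real_normK ?num_real.
  have : 0 < (s - `|rho|) ^+ 2 by rewrite exprn_even_gt0// subr_eq0.
  have -> : (s - `|rho|) ^+ 2 = w + rho ^+ 2 - 2 * (s * `|rho|).
    by rewrite sqrrB s2 real_normK ?num_real//; ring.
  move=> /lt_le_trans; apply; rewrite lerD2l lerN2 -mulrA ler_pM2l//.
  apply: le_trans (ler_norm _) _; rewrite normrM ler_wpM2r// ler_norml//.
pose F (v : R) : R := - rho^-1 * Num.sqrt (w + rho ^+ 2 - 2 * v * rho).
have cq : continuous (fun v : R => w + rho ^+ 2 - 2 * v * rho).
  move=> v; apply: cvgB; first exact: cvg_cst.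
  apply: cvgM; last exact: cvg_cst.
  by apply: cvgM; [exact: cvg_cst|exact: cvg_id].
have csq : continuous (fun v : R => Num.sqrt (w + rho ^+ 2 - 2 * v * rho)).
  by move=> v; apply: continuous_comp; [exact: cq|exact: sqrt_continuous].
transitivity ((F s - F (- s))%:E).
  apply: integral_FTC.
  - by apply: (@le_trans _ _ 0) => //; rewrite oppr_le0.
  - move=> v; rewrite in_itv/= => /pos v0; apply: cvgV; last exact: csq.
    by rewrite sqrtr_eq0 -ltNge.
  - by move=> v _; apply: cvgM; [exact: cvg_cst|exact: csq].
  - move=> v /andP[v1 v2]; have v0 := pos v; rewrite !ltW// in v0.
    have {}v0 := v0 isT.
    have d1 : is_derive v (1 : R) (fun v : R => w + rho ^+ 2 - 2 * v * rho)
        (- (2 * rho)).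
      by apply: is_derive_eq; rewrite /GRing.scale/=; ring.
    have d2 := is_derive1_sqrt v0.
    have d3 := @is_derive1_comp _ Num.sqrt
      (fun v : R => w + rho ^+ 2 - 2 * v * rho) v _ _ d2 d1.
    apply: (is_derive_eq (is_deriveZ (- rho^-1) d3)).
    have : Num.sqrt (w + rho ^+ 2 - 2 * v * rho) != 0.
      by rewrite sqrtr_eq0 -ltNge.
    move=> q0; rewrite /GRing.scale/=; field; exact/andP.
congr EFin; rewrite /F.
have -> : w + rho ^+ 2 - 2 * s * rho = (s - rho) ^+ 2 by rewrite -s2; ring.
have -> : w + rho ^+ 2 - 2 * - s * rho = (s + rho) ^+ 2 by rewrite -s2; ring.
rewrite !sqrtr_sqr /shell -/s.
have [r0|r0|r0] := ltgtP rho 0; last by rewrite r0 eqxx in rho0.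
- rewrite (ltr0_norm r0) (ger0_norm (_ : 0 <= s - rho)); last by lra.
  have [sr|sr] := leP s (- rho).
    by rewrite (ler0_norm (_ : s + rho <= 0)); [field|lra].
  by rewrite (ger0_norm (_ : 0 <= s + rho)); [field|lra].
- rewrite (gtr0_norm r0) (ger0_norm (_ : 0 <= s + rho)); last by lra.
  have [sr|sr] := leP s rho.
    by rewrite (ler0_norm (_ : s - rho <= 0)); [field|lra].
  by rewrite (ger0_norm (_ : 0 <= s - rho)); [field|lra].
Qed.

End shell.

Section shell_theorem.
Context {R : realType}.
Local Notation mu := (@lebesgue_measure R).
Local Notation RT := (measurableTypeR R).
Local Notation RT3 := (RT * RT * RT)%type.

Lemma measurable_sqn3 : measurable_fun [set: RT3] (sqn3 : RT3 -> RT).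
Proof.
apply: measurable_funD; last first.
  exact: (measurable_funX 2 (measurable_snd : measurable_fun setT (snd : RT3 -> RT))).
apply: (measurableT_comp (f := sq2)); first exact: measurable_sq2.
exact: measurable_fst.
Qed.

Lemma measurable_sqd3 (x : RT3) :
  measurable_fun [set: RT3] (fun y => sqd3 y x : RT).
Proof.
exact: (measurableT_comp measurable_sqn3
  (preserving_translation (- x.1.1, - x.1.2, - x.2)).1).
Qed.

Lemma measurable_potential_kernel (g : RT -> RT) (x : RT3) :
    measurable_fun setT g ->
  measurable_fun [set: RT3]
    (fun y => (g (sqn3 y) * (Num.sqrt (sqd3 y x))^-1)%:E).
Proof.
move=> mg; apply/measurable_EFinP.
apply: measurable_funM.
  exact: (measurableT_comp mg measurable_sqn3).
exact: (measurableT_comp measurable_invsqrt (measurable_sqd3 x)).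
Qed.

(* The squared distance [w] to the origin replaces the squared distance to the
   axis, so that the slices become [v ^+ 2 <= w]. *)
Lemma integral_axial (h : RT * RT -> RT) :
    measurable_fun setT h -> (forall p, 0 <= h p :> R) ->
  let k (p : RT * RT) : RT := if p.2 ^+ 2 <= p.1 :> R then h p else 0 in
  measurable_fun setT (EFin \o k) /\
  (\int[sf_leb3 R]_y (h (sqn3 y, y.2))%:E =
   pi%:E * \int[mu]_w \int[mu]_v (EFin \o k) (w, v))%E.
Proof.
move=> mh h0 k.
pose f (y : RT3) : \bar R := (h (sqn3 y, y.2))%:E.
have mf : measurable_fun setT f.
  apply/measurable_EFinP; apply: (measurableT_comp mh).
  apply: measurable_fun_pair => //; exact: measurable_sqn3.
have f0 y : (0 <= f y)%E by rewrite lee_fin.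
have mk : measurable_fun setT (EFin \o k).
  apply/measurable_EFinP; apply: measurable_fun_ifT => //.
  apply: measurable_fun_ler => //.
  exact: (measurable_funX 2 (measurable_snd : measurable_fun setT (snd : RT * RT -> RT))).
have k0 p : (0 <= (EFin \o k) p)%E by rewrite lee_fin /k; case: ifP.
split=> //.
transitivity (\int[mu]_v \int[sf_leb2 R]_p f (p, v))%E.
  exact: fubini_tonelli2.
transitivity (\int[mu]_v (pi%:E * \int[mu]_w (EFin \o k) (w, v)))%E.
  apply: eq_integral => v _.
  pose F (u : RT) : \bar R := (h (u + v ^+ 2 : RT, v))%:E.
  transitivity (pi%:E * \int[mu]_(u in `[0%R, +oo[) F u)%E.
    transitivity (\int[sf_leb2 R]_p F (sq2 p))%E; first exact: eq_integral.
    apply: integral_radial2; last by move=> u; rewrite lee_fin.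
    apply/measurable_EFinP; apply: (measurableT_comp mh).
    apply: measurable_fun_pair => //.
    exact: measurable_funD.
  congr (_ * _)%E; rewrite integral_mkcond.
  (* Translating by [v ^+ 2] replaces [u >= 0] by [v ^+ 2 <= w], the condition built into [k]. *)
  rewrite -(@preserving_shift R (v ^+ 2)).2//.
    apply: eq_integral => u _; rewrite patchE /k/= lerDr.
    have -> : (u \in `[0, +oo[%classic) = (0 <= u).
      by apply/idP/idP => [/set_mem|u0]; [|apply/mem_set]; rewrite /= in_itv/= andbT.
    by case: ifP.
  by apply: (measurableT_comp mk); exact: measurable_fun_pair.
rewrite (ge0_integralZl mu measurableT); last 3 first.
- exact: (measurable_fun_fubini_tonelli_G (m1 := mu) (EFin \o k)).
- by move=> v _; exact: integral_ge0.
- by rewrite lee_fin pi_ge0.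
congr (_ * _)%E.
by rewrite (fubini_tonelli (m1 := mu) (m2 := mu) (EFin \o k)).
Qed.

Lemma integral_slice (f : R -> R) (w : R) :
  (\int[mu]_v (if v ^+ 2 <= w then f v else 0)%:E =
   if (0 <= w)%R then \int[mu]_(v in `[(- Num.sqrt w)%R, Num.sqrt w]) (f v)%:E
   else 0)%E.
Proof.
case: ifPn => w0; last first.
  rewrite integral0_eq// => v _; case: ifPn => // vw.
  by move: w0; rewrite (le_trans _ vw)// sqr_ge0.
rewrite [RHS]integral_mkcond; apply: eq_integral => v _; rewrite patchE.
have -> : (v \in `[(- Num.sqrt w), Num.sqrt w]%classic) = (v ^+ 2 <= w).
  rewrite -ler_sqrt// sqrtr_sqr ler_norml.
  by apply/idP/idP => [/set_mem|u0]; [|apply/mem_set]; rewrite /= in_itv/=.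
by case: ifP.
Qed.

Lemma mem_itv0y (w : R) : (w \in `[0, +oo[%classic) = (0 <= w).
Proof.
by apply/idP/idP => [/set_mem|w0]; [|apply/mem_set]; rewrite /= in_itv/= andbT.
Qed.

Lemma shell_theorem_axis (g : RT -> RT) (rho : R) :
    measurable_fun setT g -> (forall w, 0 <= g w :> R) -> rho != 0 ->
  (\int[sf_leb3 R]_y (g (sqn3 y) * (Num.sqrt (sqd3 y (0, 0, rho)))^-1)%:E =
   pi%:E * \int[mu]_(w in `[0%R, +oo[) (g w * shell `|rho| w)%:E)%E.
Proof.
move=> mg g0 rho0.
(* In terms of the squared norm [p.1] and the height [p.2], the squared distance to the pole is
   [p.1 + rho ^+ 2 - 2 * p.2 * rho]. *)
pose h (p : RT * RT) : RT :=
  g p.1 * (Num.sqrt (p.1 + rho ^+ 2 - 2 * p.2 * rho : R))^-1.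
have mh : measurable_fun setT h.
  apply: measurable_funM; first exact: measurableT_comp.
  apply: (measurableT_comp measurable_invsqrt).
  apply: measurable_funB.
    by apply: measurable_funD.
  apply: measurable_funM => //.
  exact: measurable_funM.
have h0 p : 0 <= h p :> R by rewrite mulr_ge0// invr_ge0 sqrtr_ge0.
transitivity (\int[sf_leb3 R]_y (h (sqn3 y, y.2))%:E)%E.
  apply: eq_integral => y _; rewrite /h/=.
  by congr ((_ * (Num.sqrt _)^-1)%:E); rewrite /sqd3 /sqn3/= !subr0; ring.
have [mk ->] := integral_axial mh h0; set k := EFin \o _ in mk *.
have k0 p : (0 <= k p)%E by rewrite /k/= lee_fin; case: ifP.
congr (_ * _)%E; rewrite [RHS]integral_mkcond; apply: ae_eq_integral => //.
- exact: (measurable_fun_fubini_tonelli_F (m2 := mu) k).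
- apply/(measurable_restrictT _ _).1 => //; apply: measurable_funTS.
  apply/measurable_EFinP; apply: measurable_funM => //.
  exact: measurable_shell.
(* The sphere through the pole is discarded as a null set of [w]. *)
exists [set rho ^+ 2]; split=> //; first exact: lebesgue_measure_set1.
move=> w /=; apply: contra_notP => /eqP wrho _.
rewrite /k/= (integral_slice (fun v => h (w, v))) patchE mem_itv0y.
case: ifP => // w0.
transitivity (\int[mu]_(v in `[(- Num.sqrt w)%R, Num.sqrt w])
    ((g w)%:E * ((Num.sqrt (w + rho ^+ 2 - 2 * v * rho))^-1)%:E))%E.
  exact: eq_integral.
rewrite ge0_integralZl//.
- by rewrite integral_invsqrt_shell ?EFinM.
- apply/measurable_EFinP; apply: measurable_funTS.
  apply: (measurableT_comp measurable_invsqrt).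
  apply: measurable_funB => //.
  by apply: measurable_funM.
- by rewrite lee_fin.
Qed.

(** The axial reduction with a constant kernel: the inner integral is the length [2 * sqrt w] of the
    range of heights. *)
Lemma integral_volume (g : RT -> RT) :
    measurable_fun setT g -> (forall w, 0 <= g w :> R) ->
  (\int[sf_leb3 R]_y (g (sqn3 y))%:E =
   pi%:E * \int[mu]_(w in `[0%R, +oo[) (g w * (2 * Num.sqrt w))%:E)%E.
Proof.
move=> mg g0.
have mh : measurable_fun setT (fun p : RT * RT => g p.1).
  exact: (measurableT_comp mg).
have [_ H] := integral_axial mh (fun p => g0 p.1); rewrite {}[LHS]H.
congr (_ * _)%E; rewrite [RHS]integral_mkcond; apply: eq_integral => w _ /=.
rewrite (integral_slice (fun _ => g w)) patchE mem_itv0y; case: ifP => // w0.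
rewrite integral_cst//= EFinM; congr (_ * _)%E.
rewrite lebesgue_measure_itv/= lte_fin.
have := sqrtr_ge0 w; rewrite le_eqVlt => /predU1P[<-|s0].
  by rewrite oppr0 ltxx mulr0.
rewrite (lt_trans _ s0) ?oppr_lt0// -EFinD; congr EFin; ring.
Qed.

End shell_theorem.

(** * Potentials and volume integrals of radial densities *)

Section newton_radial.
Context {R : realType}.
Local Notation mu := (@lebesgue_measure R).
Local Notation RT := (measurableTypeR R).
Local Notation RT3 := (RT * RT * RT)%type.

Lemma sqn3_ge0 (x : R3 R) : 0 <= sqn3 x.
Proof. by rewrite !addr_ge0// sqr_ge0. Qed.

Lemma sqn3_eq0 (x : R3 R) : sqn3 x = 0 -> x = (0, 0, 0).
Proof.
case: x => [[x1 x2] x3]; rewrite /sqn3/= => /eqP.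
rewrite paddr_eq0 ?addr_ge0 ?sqr_ge0// paddr_eq0 ?sqr_ge0// !sqrf_eq0.
by move=> /andP[/andP[/eqP-> /eqP->] /eqP->].
Qed.

Lemma sqd3C (x y : R3 R) : sqd3 x y = sqd3 y x.
Proof. by rewrite /sqd3; ring. Qed.

Lemma dist3E (x y : R3 R) : dist3 x y = Num.sqrt (sqd3 y x).
Proof. by rewrite sqd3C. Qed.

Lemma dist3_gt0 (x z : R3 R) : x <> z -> 0 < dist3 x z.
Proof.
move=> xz; rewrite lt_neqAle sqrtr_ge0 andbT; apply/eqP => d0; apply: xz.
have : sqn3 (x.1.1 - z.1.1, x.1.2 - z.1.2, x.2 - z.2) = 0.
  apply/eqP; rewrite eq_le sqn3_ge0 andbT -sqrtr_eq0.
  by rewrite [X in X == _](_ : _ = dist3 x z)// -d0.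
move=> /sqn3_eq0[/subr0_eq e1 /subr0_eq e2 /subr0_eq e3].
by case: x z e1 e2 e3 {d0} => [[? ?] ?] [[? ?] ?] /= -> -> ->.
Qed.

Lemma shell_theorem_origin (g : RT -> RT) (x : RT3) :
    measurable_fun setT g -> (forall w, 0 <= g w :> R) -> sqn3 x != 0 ->
  (\int[sf_leb3 R]_y (g (sqn3 y) * (Num.sqrt (sqd3 y x))^-1)%:E =
   pi%:E * \int[mu]_(w in `[0%R, +oo[)
             (g w * shell (Num.sqrt (sqn3 x)) w)%:E)%E.
Proof.
move=> mg g0 x0; have [T pT [r Tr]] := rotation_to_axis x.
(* [T] preserves norms, so it fixes the origin; comparing distances from the origin gives [r] up to
   sign, which suffices since only [|r|] enters the formula. *)
have r2 : r ^+ 2 = sqn3 x.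
  have s0 : sqn3 ((0, 0, 0) : R3 R) = 0 by rewrite /sqn3/= expr0n !addr0.
  have [Tn Td] := Tr (0, 0, 0); have T0 := sqn3_eq0 (etrans Tn s0).
  by move: Td; rewrite T0 /sqd3 /sqn3/= !sub0r !sqrrN expr0n !add0r.
have r0 : r != 0 by rewrite -sqrf_eq0 r2.
rewrite -r2 sqrtr_sqr -shell_theorem_axis// -[RHS]pT.2.
- by apply: eq_integral => y _; have [-> ->] := Tr y.
- exact: measurable_potential_kernel.
- by move=> y; rewrite lee_fin mulr_ge0// invr_ge0 sqrtr_ge0.
Qed.

Lemma shell_theorem (g : RT -> RT) (x z : RT3) :
    measurable_fun setT g -> (forall w, 0 <= g w :> R) -> x <> z ->
  (\int[sf_leb3 R]_y (g (sqd3 y z) * (4 * pi * dist3 x y)^-1)%:E =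
   \int[mu]_(w in `[0%R, +oo[) (g w * (shell (dist3 x z) w / 4))%:E)%E.
Proof.
move=> mg g0 xz; pose x' : RT3 := (x.1.1 - z.1.1, x.1.2 - z.1.2, x.2 - z.2).
have dE : dist3 x z = Num.sqrt (sqn3 x') by [].
have x'0 : sqn3 x' != 0.
  by have := dist3_gt0 xz; rewrite dE sqrtr_gt0 => /lt0r_neq0.
have pi0 : pi != 0 :> R by rewrite gt_eqF// pi_gt0.
transitivity (\int[sf_leb3 R]_y ((4 * pi)^-1%:E *
    (g (sqn3 y) * (Num.sqrt (sqd3 y x'))^-1)%:E))%E.
  rewrite -[RHS](preserving_translation (- z.1.1, - z.1.2, - z.2)).2.
  - apply: eq_integral => y _; rewrite -EFinM; congr EFin.
    rewrite dist3E /= [sqd3 (_, _, _) _](_ : _ = sqd3 y x); last first.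
      by rewrite /sqd3/=; ring.
    by rewrite invfM mulrCA.
  - apply: measurable_funeM.
    exact: measurable_potential_kernel.
  - move=> y; rewrite -EFinM lee_fin !mulr_ge0// ?invr_ge0 ?sqrtr_ge0//.
    by rewrite mulr_ge0// pi_ge0.
rewrite (ge0_integralZl_EFin _ measurableT); last 3 first.
- by move=> y _; rewrite lee_fin mulr_ge0// invr_ge0 sqrtr_ge0.
- exact: measurable_potential_kernel.
- by rewrite invr_ge0 mulr_ge0// pi_ge0.
rewrite shell_theorem_origin// -dE muleA -EFinM.
rewrite -ge0_integralZl_EFin//; last first.
- by rewrite mulr_ge0 ?pi_ge0// invr_ge0 mulr_ge0// pi_ge0.
- apply: measurable_funTS; apply/measurable_EFinP.
  by apply: measurable_funM => //; exact: measurable_shell.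
- by move=> w _; rewrite lee_fin mulr_ge0// shell_ge0// sqrtr_ge0.
apply: eq_integral => w _; rewrite -EFinM; congr EFin.
by move: (pi : R) pi0 => p p0; field.
Qed.

(** Against a nonnegative kernel, the positive and negative parts only affect the density;
    identities for nonnegative densities thereby pass to signed ones. *)
Lemma funeposneg_mulr T (u k : T -> R) : (forall t, 0 <= k t) ->
  (fun t => (u t * k t)%:E)^\+%E = (fun t => (Num.max (u t) 0 * k t)%:E) /\
  (fun t => (u t * k t)%:E)^\-%E = (fun t => (Num.max (- u t) 0 * k t)%:E).
Proof.
move=> k0; split; apply/funext => t.
  by rewrite funeposE -EFin_max maxr_pMl// mul0r.
by rewrite funenegE -EFinN -EFin_max -mulNr maxr_pMl// mul0r.
Qed.

(** Both sides are differences of the same two extended numbers, so the identity holds whether or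
    not the integrals are finite. *)
Lemma shell_theorem_signed (g : RT -> RT) (x z : RT3) :
    measurable_fun setT g -> x <> z ->
  (\int[sf_leb3 R]_y (g (sqd3 y z) * (4 * pi * dist3 x y)^-1)%:E =
   \int[mu]_(w in `[0%R, +oo[) (g w * (shell (dist3 x z) w / 4))%:E)%E.
Proof.
move=> mg xz; have pi0 : 0 <= pi :> R := pi_ge0 R.
have mpos : measurable_fun setT (fun w : RT => Num.max (g w : R) 0 : RT).
  by apply: measurable_maxr.
have mneg : measurable_fun setT (fun w : RT => Num.max (- (g w : R)) 0 : RT).
  by apply: measurable_maxr => //;
    exact: measurable_funN.
have k1 (y : RT3) : 0 <= (4 * pi * dist3 x y)^-1.
  by rewrite invr_ge0 !mulr_ge0// sqrtr_ge0.
have k2 (w : RT) : 0 <= shell (dist3 x z) w / 4.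
  by rewrite divr_ge0// shell_ge0// sqrtr_ge0.
have [p1 n1] := funeposneg_mulr (fun y => g (sqd3 y z)) k1.
have [p2 n2] := funeposneg_mulr g k2.
rewrite integralE [RHS]integralE p1 n1 p2 n2.
rewrite (shell_theorem mpos)//; last by move=> w; rewrite le_max lexx orbT.
by rewrite (shell_theorem mneg)// => w; rewrite le_max lexx orbT.
Qed.

(* The factor [1] gives the integrand the shape of [funeposneg_mulr]. *)
Lemma ge0_integral_ball_volume (g : RT -> RT) (z : RT3) :
    measurable_fun setT g -> (forall w, 0 <= g w :> R) ->
  (\int[sf_leb3 R]_y (g (sqd3 y z) * 1)%:E =
   \int[mu]_(w in `[0%R, +oo[) (g w * (2 * pi * Num.sqrt w))%:E)%E.
Proof.
move=> mg g0.
transitivity (\int[sf_leb3 R]_y (g (sqn3 y))%:E)%E.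
  rewrite -[RHS](preserving_translation (- z.1.1, - z.1.2, - z.2)).2.
  - by apply: eq_integral => y _; rewrite mulr1.
  - apply/measurable_EFinP; apply: (measurableT_comp mg); exact: measurable_sqn3.
  - by move=> y; rewrite lee_fin.
rewrite integral_volume// -ge0_integralZl_EFin//; last first.
- exact: pi_ge0.
- apply: measurable_funTS; apply/measurable_EFinP.
  apply: measurable_funM => //.
  apply: measurable_funM => //.
  by apply: continuous_measurable_fun; exact: sqrt_continuous.
- by move=> w _; rewrite lee_fin !mulr_ge0// sqrtr_ge0.
apply: eq_integral => w _; rewrite -EFinM; congr EFin.
by move: (pi : R) => p; ring.
Qed.

Lemma integral_ball_volume (g : RT -> RT) (z : RT3) : measurable_fun setT g ->
  (\int[sf_leb3 R]_y (g (sqd3 y z) * 1)%:E =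
   \int[mu]_(w in `[0%R, +oo[) (g w * (2 * pi * Num.sqrt w))%:E)%E.
Proof.
move=> mg.
have mpos : measurable_fun setT (fun w : RT => Num.max (g w : R) 0 : RT).
  by apply: measurable_maxr.
have mneg : measurable_fun setT (fun w : RT => Num.max (- (g w : R)) 0 : RT).
  by apply: measurable_maxr => //;
    exact: measurable_funN.
have k2 (w : RT) : 0 <= 2 * pi * Num.sqrt (w : R).
  by rewrite !mulr_ge0 ?sqrtr_ge0// pi_ge0.
have [p1 n1] := funeposneg_mulr (fun y : RT3 => g (sqd3 y z)) (fun _ => ler01).
have [p2 n2] := funeposneg_mulr g k2.
rewrite integralE [RHS]integralE p1 n1 p2 n2.
rewrite (ge0_integral_ball_volume _ mpos)//; last first.
  by move=> w; rewrite le_max lexx orbT.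
by rewrite (ge0_integral_ball_volume _ mneg)// => w; rewrite le_max lexx orbT.
Qed.

End newton_radial.

(** * The Newtonian operator on radial functions *)

Section newton_sinc.
Context {R : realType}.
Local Notation mu := (@lebesgue_measure R).
Local Notation RT := (measurableTypeR R).
Local Notation RT3 := (RT * RT * RT)%type.

Lemma ball3E (z : R3 R) (a : R) (y : R3 R) : 0 < a ->
  (y \in ball3 z a) = (sqd3 y z < a ^+ 2).
Proof.
move=> a0; have -> : (sqd3 y z < a ^+ 2) = (dist3 z y < a).
  rewrite dist3E -[in RHS](gtr0_norm a0) -sqrtr_sqr.
  by rewrite [RHS]ltr_sqrt// exprn_gt0.
by apply/idP/idP => [/set_mem//|ya]; exact/mem_set.
Qed.

Lemma newtonian_radial (g : RT -> RT) (x z : R3 R) (a : R) : 0 < a ->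
    measurable_fun setT g -> x <> z ->
  newtonian (ball3 z a) (fun y => g (sqd3 y z)) x =
  Rintegral mu `[0, a ^+ 2[ (fun w => g w * (shell (dist3 x z) w / 4)).
Proof.
move=> a0 mg xz; rewrite /newtonian /Rintegral; congr fine.
(* Being in the ball depends only on the squared distance, so the cut-off density is still
   radial. *)
pose ga (w : RT) : RT := if (w : R) < a ^+ 2 then g w else 0.
have mga : measurable_fun setT ga.
  apply: measurable_fun_ifT => //.
  by apply: measurable_fun_ltr.
transitivity (\int[sf_leb3 R]_(y in ball3 z a)
  (g (sqd3 y z) * (4 * pi * dist3 x y)^-1)%:E)%E; first by [].
rewrite [LHS]integral_mkcond.
transitivity (\int[sf_leb3 R]_y (ga (sqd3 y z) * (4 * pi * dist3 x y)^-1)%:E)%E.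
  apply: (@eq_integral _ _ _ (sf_leb3 R) setT) => y _.
  rewrite patchE (ball3E _ _ a0) /ga.
  by case: ifP => // _; rewrite mul0r.
rewrite shell_theorem_signed// [LHS]integral_mkcond [RHS]integral_mkcond.
apply: eq_integral => w _; rewrite !patchE /ga.
have -> : (w \in `[0, a ^+ 2[%classic) = (w \in `[0, +oo[%classic) && (w < a ^+ 2).
  apply/idP/andP => [/set_mem|[/set_mem]]; rewrite /= in_itv/=.
    by move=> /andP[w0 wa]; split=> //; apply/mem_set; rewrite /= in_itv/= andbT.
  by rewrite andbT => w0 wa; apply/mem_set; rewrite /= in_itv/= w0.
by case: ifP => //= _; case: ifP => //; rewrite mul0r.
Qed.

(** The function [g_k] in the squared radius. At [w = 0] its value is 0 instead of the limit [k], a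
    change at the centre only. *)
Definition sinc_sqrt (k : R) (w : R) : R := sin (k * Num.sqrt w) / Num.sqrt w.

Lemma measurable_sinc_sqrt k :
  measurable_fun [set: RT] (sinc_sqrt k : RT -> RT).
Proof.
apply: measurable_funM; last exact: measurable_invsqrt.
apply: continuous_measurable_fun => w; apply: continuous_comp.
  by apply: cvgM; [exact: cvg_cst|exact: sqrt_continuous].
exact: continuous_sin.
Qed.

Lemma norm_sin_le (t : R) : 0 <= t -> `|sin t| <= t.
Proof.
move=> t0; have [|c _] := @MVT_segment R sin cos 0 t t0.
  by apply: continuous_subspaceT; exact: continuous_sin.
rewrite sin0 !subr0 => ->; rewrite normrM (ger0_norm t0).
by rewrite ler_piMl// ler_norml cos_geN1 cos_le1.
Qed.

Lemma norm_sinc_sqrt_le k w : 0 <= k -> `|sinc_sqrt k w| <= k.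
Proof.
move=> k0; have [s0|s0] := eqVneq (Num.sqrt w) 0.
  by rewrite /sinc_sqrt s0 mulr0 sin0 mul0r normr0.
have s_gt0 : 0 < Num.sqrt w by rewrite lt_neqAle eq_sym s0 sqrtr_ge0.
rewrite /sinc_sqrt normrM normfV (gtr0_norm s_gt0) ler_pdivrMr//.
by apply: norm_sin_le; rewrite mulr_ge0 ?sqrtr_ge0.
Qed.

Lemma continuous_sin_sqrt (c : R) : continuous (fun w : R => sin (c * Num.sqrt w)).
Proof.
move=> w; apply: continuous_comp; last exact: continuous_sin.
by apply: cvgM; [exact: cvg_cst|exact: sqrt_continuous].
Qed.

Lemma continuous_cos_sqrt (c : R) : continuous (fun w : R => cos (c * Num.sqrt w)).
Proof.
move=> w; apply: continuous_comp; last exact: continuous_cos.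
by apply: cvgM; [exact: cvg_cst|exact: sqrt_continuous].
Qed.

Lemma is_derive_sin_sqrt (k w : R) : 0 < w -> is_derive w (1 : R)
  (fun w : R => sin (k * Num.sqrt w))
  (cos (k * Num.sqrt w) * (k * (2 * Num.sqrt w)^-1)).
Proof.
move=> w0; exact: (@is_derive1_comp _ sin (fun w : R => k * Num.sqrt w) w _ _
  (is_derive_sin _) (is_deriveZ k (is_derive1_sqrt w0))).
Qed.

Lemma is_derive_cos_sqrt (k w : R) : 0 < w -> is_derive w (1 : R)
  (fun w : R => cos (k * Num.sqrt w))
  (- sin (k * Num.sqrt w) * (k * (2 * Num.sqrt w)^-1)).
Proof.
move=> w0; exact: (@is_derive1_comp _ cos (fun w : R => k * Num.sqrt w) w _ _
  (is_derive_cos _) (is_deriveZ k (is_derive1_sqrt w0))).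
Qed.

Lemma integral_sin_sqrt (c k b : R) : 0 < k -> 0 <= b ->
  (\int[mu]_(w in `[0%R, (b ^+ 2)%R]) (c * sin (k * Num.sqrt w))%:E =
   (2 * c * (sin (k * b) / k ^+ 2 - b * cos (k * b) / k))%:E)%E.
Proof.
move=> k0 b0; have k0' := lt0r_neq0 k0.
(* With [w = s ^+ 2] the integrand becomes [2 * c * s * sin (k * s)], integrated by parts. *)
pose F (w : R) : R := (2 * c) *
  (k ^- 2 * sin (k * Num.sqrt w) - k^-1 * (Num.sqrt w * cos (k * Num.sqrt w))).
transitivity ((F (b ^+ 2) - F 0)%:E); last first.
  rewrite /F sqrtr0 !mulr0 sin0 !mul0r !mulr0 sqrtr_sqr (ger0_norm b0).
  by congr EFin; field.
apply: integral_FTC.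
- exact: sqr_ge0.
- move=> w _; apply: cvgM; first exact: cvg_cst.
  exact: continuous_sin_sqrt.
- move=> w _; apply: cvgM; first exact: cvg_cst.
  apply: cvgB.
    by apply: cvgM; [exact: cvg_cst|exact: continuous_sin_sqrt].
  apply: cvgM; first exact: cvg_cst.
  by apply: cvgM; [exact: sqrt_continuous|exact: continuous_cos_sqrt].
- move=> w /andP[w0 _].
  have d1 := is_deriveZ (k ^- 2) (is_derive_sin_sqrt k w0).
  have d2 := is_deriveZ (k^-1)
    (is_deriveM (is_derive1_sqrt w0) (is_derive_cos_sqrt k w0)).
  apply: (is_derive_eq (is_deriveZ (2 * c) (is_deriveB d1 d2))).
  have s0 : Num.sqrt w != 0 by rewrite sqrtr_eq0 -ltNge.
  by rewrite /GRing.scale/=; field; rewrite s0 ?k0'.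
Qed.

(** The minimum in [shell] changes at [w = r ^+ 2]: below, the integrand is
    [sin (k sqrt w) / (2 r)], above it is [sin (k sqrt w) / (2 sqrt w)]. The two terms
    [cos (k * r) / k] cancel, and only the cosine at the boundary of the ball remains. *)
Lemma integral_sinc_shell (k r a : R) : 0 < k -> 0 < r -> r < a ->
  (\int[mu]_(w in `[0%R, (a ^+ 2)%R[) (sinc_sqrt k w * (shell r w / 4))%:E =
   (sin (k * r) / r / k ^+ 2 - cos (k * a) / k)%:E)%E.
Proof.
move=> k0 r0 ra; have a0 : 0 < a by exact: lt_trans ra.
have k0' := lt0r_neq0 k0; have r0' := lt0r_neq0 r0.
have r2a2 : r ^+ 2 < a ^+ 2 by rewrite ltrXn2r// ?nnegrE ltW.
have mf : measurable_fun [set: RT]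
    (fun w : RT => (sinc_sqrt k w * (shell r w / 4))%:E).
  apply/measurable_EFinP; apply: measurable_funM.
    exact: measurable_sinc_sqrt.
  apply: measurable_funM => //; exact: measurable_shell.
rewrite integral_itv_bndo_bndc; last exact: measurable_funTS.
have -> : `[0, a ^+ 2]%classic = (`[0, r ^+ 2] `|` `]r ^+ 2, a ^+ 2])%classic :> set R.
  by rewrite -itv_bndbnd_setU// bnd_simp ?sqr_ge0// ltW.
rewrite integral_setU_EFin//; last 2 first.
- by apply: measurable_funTS; exact/measurable_EFinP.
- apply/disj_setPS => w /= []; rewrite !in_itv/= => /andP[_ w1] /andP[w2 _].
  by have := lt_le_trans w2 w1; rewrite ltxx.
rewrite [X in (_ + X)%E]integral_itv_obnd_cbnd; last exact: measurable_funTS.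
pose F2 (w : R) : R := - k^-1 * cos (k * Num.sqrt w).
transitivity ((2 * (2 * r)^-1 * (sin (k * r) / k ^+ 2 - r * cos (k * r) / k))%:E + (F2 (a ^+ 2) - F2 (r ^+ 2))%:E)%E.
  congr (_ + _)%E.
  - transitivity (\int[mu]_(w in `[0%R, (r ^+ 2)%R])
      ((2 * r)^-1 * sin (k * Num.sqrt w))%:E)%E.
      apply: eq_integral => w /set_mem; rewrite /= in_itv/= => /andP[w0 wr].
      congr EFin; rewrite /sinc_sqrt /shell.
      have sr : Num.sqrt w <= r.
        rewrite -(@ler_pXn2r _ 2)// ?nnegrE ?sqrtr_ge0 ?(ltW r0)//. rewrite sqr_sqrtr; [exact: wr|exact: w0].
      rewrite min_l//; have [->|s0] := eqVneq (Num.sqrt w) 0.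
        by rewrite !mulr0 sin0 !mul0r mulr0.
      by field; exact/andP.
    exact: (integral_sin_sqrt _ k0 (ltW r0)).
  - transitivity (\int[mu]_(w in `[(r ^+ 2)%R, (a ^+ 2)%R])
      (sin (k * Num.sqrt w) * (2 * Num.sqrt w)^-1)%:E)%E.
      apply: eq_integral => w /set_mem; rewrite /= in_itv/= => /andP[w0 wr].
      congr EFin; rewrite /sinc_sqrt /shell.
      have sr : r <= Num.sqrt w.
        rewrite -(@ler_pXn2r _ 2)// ?nnegrE ?sqrtr_ge0 ?(ltW r0)//.
        rewrite sqr_sqrtr; first exact: w0.
        by apply: le_trans w0; exact: sqr_ge0.
      have s0 : Num.sqrt w != 0 by rewrite gt_eqF// (lt_le_trans r0).
      by rewrite min_r//; field; exact/andP.
    apply: integral_FTC.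
    + exact: ltW.
    + move=> w; rewrite in_itv/= => /andP[rw _]; apply: cvgM; first exact: continuous_sin_sqrt.
      apply: cvgV; last by apply: cvgM; [exact: cvg_cst|exact: sqrt_continuous].
      rewrite mulf_neq0// sqrtr_eq0 -ltNge.
      by apply: lt_le_trans rw; rewrite exprn_gt0.
    + by move=> w _; apply: cvgM; [exact: cvg_cst|exact: continuous_cos_sqrt].
    + move=> w /andP[rw _].
      have w0 : 0 < w by apply: lt_trans rw; rewrite exprn_gt0.
      apply: (is_derive_eq (is_deriveZ (- k^-1) (is_derive_cos_sqrt k w0))).
      have s0 : Num.sqrt w != 0 by rewrite sqrtr_eq0 -ltNge.
      by rewrite /GRing.scale/=; field; exact/andP.
rewrite -EFinD; congr EFin; rewrite /F2.
rewrite !sqrtr_sqr (gtr0_norm r0) (gtr0_norm a0).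
by field; exact/andP.
Qed.

Lemma newtonian_sinc (k a : R) (x z : R3 R) : 0 < k -> 0 < a ->
    ball3 z a x -> x <> z ->
  newtonian (ball3 z a) (fun y => sinc_sqrt k (sqd3 y z)) x =
  sinc_sqrt k (sqd3 x z) / k ^+ 2 - cos (k * a) / k.
Proof.
move=> k0 a0 xD xz.
have d0 : 0 < dist3 x z by exact: dist3_gt0.
have da : dist3 x z < a by rewrite dist3E sqd3C -dist3E.
rewrite newtonian_radial//; last exact: measurable_sinc_sqrt.
by rewrite /Rintegral integral_sinc_shell.
Qed.

(** Since [shell r w / 4 <= 1 / 2], the potential is at most half the length of [[0, a ^+ 2]]. All
    integrability of the kernel below comes from this uniform bound. *)
Lemma ge0_newton_kernel_bound (a : R) (x z : RT3) : 0 < a -> x <> z ->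
  (\int[sf_leb3 R]_(y in ball3 z a) ((4 * pi * dist3 x y)^-1)%:E <=
   (a ^+ 2 / 2)%:E)%E.
Proof.
move=> a0 xz.
pose ga (w : RT) : RT := if (w : R) < a ^+ 2 then 1 else 0.
have mga : measurable_fun setT ga.
  apply: measurable_fun_ifT => //.
  by apply: measurable_fun_ltr.
rewrite [leLHS]integral_mkcond.
rewrite (_ : integral _ _ _ =
  (\int[sf_leb3 R]_y (ga (sqd3 y z) * (4 * pi * dist3 x y)^-1)%:E)%E); last first.
  apply: (@eq_integral _ _ _ (sf_leb3 R) setT) => y _.
  rewrite patchE (ball3E _ _ a0) /ga.
  by case: ifP => // _; rewrite ?mul1r ?mul0r.
rewrite shell_theorem_signed//.
have -> : (a ^+ 2 / 2)%:E = (\int[mu]_(w in `[0%R, (a ^+ 2)%R]) (2^-1)%:E)%E.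
  rewrite integral_cst//= lebesgue_measure_itv/= lte_fin exprn_gt0// sube0.
  by rewrite -EFinM mulrC.
rewrite [leLHS]integral_mkcond [leRHS]integral_mkcond.
apply: ge0_le_integral => //.
- move=> w _; rewrite patchE; case: ifP => // _; rewrite lee_fin mulr_ge0//.
    by rewrite /ga; case: ifP.
  by rewrite divr_ge0// shell_ge0// sqrtr_ge0.
- apply/(measurable_restrictT _ _).1 => //; apply: measurable_funTS.
  apply/measurable_EFinP; apply: measurable_funM => //.
  by apply: measurable_funM => //; exact: measurable_shell.
- apply/(measurable_restrictT _ _).1 => //.
move=> w _; rewrite !patchE.
case: ifPn => [/set_mem|_]; last by case: ifP => // _; rewrite lee_fin.
rewrite /= in_itv/= andbT => w0.
rewrite /ga; case: ifPn => wa; last first.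
  by rewrite mul0r; case: ifP => // _; rewrite lee_fin.
rewrite mem_set; last by rewrite /= in_itv/= w0 ltW.
have d0 := dist3_gt0 xz.
rewrite lee_fin mul1r /shell ler_pdivrMr// ler_pdivrMr//.
have -> : 2^-1 * 4 * dist3 x z = 2 * dist3 x z :> R by field.
by rewrite ler_pM2l// ge_min lexx orbT.
Qed.

(** Its purpose is the nonzero mean: when [cos (k * a) = 0] the value is
    [4 * pi * sin (k * a) / k ^+ 2]. *)
Lemma Rintegral_sinc_ball (k a : R) (z : R3 R) : 0 < k -> 0 < a ->
  Rintegral (@leb3 R) (ball3 z a) (fun y => sinc_sqrt k (sqd3 y z)) =
  4 * pi * (sin (k * a) / k ^+ 2 - a * cos (k * a) / k).
Proof.
move=> k0 a0; rewrite /Rintegral.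
pose ga (w : RT) : RT := if (w : R) < a ^+ 2 then sinc_sqrt k w else 0.
have mga : measurable_fun setT ga.
  apply: measurable_fun_ifT => //.
    by apply: measurable_fun_ltr.
  exact: measurable_sinc_sqrt.
transitivity (fine (\int[sf_leb3 R]_y (ga (sqd3 y z) * 1)%:E)%E).
  congr fine; rewrite -[LHS]/(\int[sf_leb3 R]_(y in ball3 z a)
    (sinc_sqrt k (sqd3 y z))%:E)%E [LHS]integral_mkcond.
  apply: (@eq_integral _ _ _ (sf_leb3 R) setT) => y _.
  rewrite patchE (ball3E _ _ a0) /ga mulr1.
  by case: ifP.
rewrite integral_ball_volume//.
transitivity (fine (\int[mu]_(w in `[0%R, (a ^+ 2)%R])
    (2 * pi * sin (k * Num.sqrt w))%:E)%E); last first.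
  by rewrite integral_sin_sqrt ?(ltW a0)//=; move: (pi : R) => p; ring.
congr fine; rewrite -integral_itv_bndo_bndc; last first.
  apply/measurable_EFinP; apply: measurable_funTS.
  apply: measurable_funM => //.
  by apply: continuous_measurable_fun; exact: continuous_sin_sqrt.
rewrite [LHS]integral_mkcond [RHS]integral_mkcond.
apply: eq_integral => w _; rewrite !patchE mem_itv0y /ga.
have -> : (w \in `[0, a ^+ 2[%classic) = (0 <= w) && (w < a ^+ 2).
  by apply/idP/idP => [/set_mem|H]; [|apply/mem_set]; rewrite /= in_itv/=.
case: ifP => //= w0; case: ifP => wa; last by rewrite mul0r.
congr EFin; rewrite /sinc_sqrt.
have [->|s0] := eqVneq (Num.sqrt w) 0; first by rewrite !mulr0 sin0 mulr0.
by move: (pi : R) => p; field.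
Qed.

End newton_sinc.

(** * Integrability of the Newtonian kernel *)

Section newton_operator.
Context {R : realType}.
Local Notation mu := (@lebesgue_measure R).
Local Notation RT := (measurableTypeR R).
Local Notation RT3 := (RT * RT * RT)%type.
Local Notation leb := (sf_leb3 R).

Lemma measurable_ball3 (z : RT3) (a : R) : 0 < a ->
  measurable (ball3 z a : set RT3).
Proof.
move=> a0; have -> : ball3 z a = (fun y : RT3 => sqd3 y z : RT) @^-1` `]-oo, a ^+ 2[.
  apply/seteqP; split=> y /=; rewrite in_itv/= -ball3E//.
    by move=> ya; exact/mem_set.
  by move=> /set_mem.
rewrite -[X in measurable X]setTI.
by apply: measurable_sqd3 => //; exact: measurable_itv.
Qed.

Lemma set1_prod3 (z : RT3) :
  [set z] = ([set z.1.1] `*` [set z.1.2]) `*` [set z.2].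
Proof.
apply/seteqP; split=> [y ->//|[[y1 y2] y3] /= [[-> ->] ->]].
by case: z => [[? ?] ?].
Qed.

Lemma measurable_set1_3 (z : RT3) : measurable [set z].
Proof.
have m1 (x : RT) : measurable [set x] by exact: measurable_set1.
by rewrite set1_prod3; apply: measurableX => //; exact: measurableX.
Qed.

Lemma leb3_set1 (z : RT3) : leb [set z] = 0%E.
Proof.
have m1 (x : RT) : measurable [set x] by exact: measurable_set1.
rewrite set1_prod3.
rewrite [LHS](product_measure1E (sf_leb2 R) mu)//; last exact: measurableX.
by rewrite [X in (_ * X)%E]lebesgue_measure_set1 mule0.
Qed.

Lemma leb3_ball3_lty (z : RT3) (a : R) : 0 < a -> (leb (ball3 z a) < +oo)%E.
Proof.
move=> a0; have mD := measurable_ball3 z a0.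
pose ga (w : RT) : RT := if (w : R) < a ^+ 2 then 1 else 0.
have mga : measurable_fun setT ga.
  apply: measurable_fun_ifT => //.
  by apply: measurable_fun_ltr.
have -> : leb (ball3 z a) = (\int[leb]_y (ga (sqd3 y z) * 1)%:E)%E.
  rewrite -[LHS]mul1e -integral_cst// [LHS]integral_mkcond.
  apply: eq_integral => y _; rewrite patchE ball3E// /ga mulr1.
  by case: ifP.
rewrite integral_ball_volume//.
apply: (@le_lt_trans _ _ (\int[mu]_(w in `[0%R, (a ^+ 2)%R]) (2 * pi * a)%:E)%E).
  rewrite [leLHS]integral_mkcond [leRHS]integral_mkcond.
  have pi0 := pi_ge0 R.
  apply: ge0_le_integral => //.
  - move=> w _; rewrite patchE; case: ifP => // _; rewrite lee_fin mulr_ge0//.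
      by rewrite /ga; case: ifP.
    by rewrite !mulr_ge0// sqrtr_ge0.
  - apply/(measurable_restrictT _ _).1 => //; apply: measurable_funTS.
    apply/measurable_EFinP; apply: measurable_funM => //.
    apply: measurable_funM => //.
    by apply: continuous_measurable_fun; exact: sqrt_continuous.
  - by apply/(measurable_restrictT _ _).1.
  move=> w _; rewrite !patchE mem_itv0y.
  have a2 : 0 <= 2 * pi * a by rewrite !mulr_ge0// ltW.
  case: ifP => w0; last by case: ifP => // _; rewrite lee_fin.
  rewrite /ga; case: ifPn => wa; last first.
    by rewrite mul0r; case: ifP => // _; rewrite lee_fin.
  rewrite mem_set; last by rewrite /= in_itv/= w0 ltW.
  rewrite lee_fin mul1r ler_wpM2l// ?mulr_ge0//.
  by rewrite -(@ler_pXn2r _ 2)// ?nnegrE ?sqrtr_ge0 ?(ltW a0)// sqr_sqrtr// ltW.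
rewrite integral_cst//= lebesgue_measure_itv/= lte_fin exprn_gt0// sube0.
by rewrite -EFinM ltry.
Qed.

Definition newton_kernel (x y : R3 R) : R := (4 * pi * dist3 x y)^-1.

Lemma newton_kernel_ge0 x y : 0 <= newton_kernel x y.
Proof. by rewrite invr_ge0 !mulr_ge0 ?pi_ge0// sqrtr_ge0. Qed.

Lemma newton_kernelC x y : newton_kernel x y = newton_kernel y x.
Proof. by rewrite /newton_kernel !dist3E sqd3C. Qed.

Lemma measurable_newton_kernel :
  measurable_fun setT (fun p : RT3 * RT3 => newton_kernel p.1 p.2 : RT).
Proof.
have -> : (fun p : RT3 * RT3 => newton_kernel p.1 p.2 : RT) =
    (fun p => (4 * pi)^-1 * (Num.sqrt (sqd3 p.1 p.2))^-1).
  by apply/funext => p; rewrite /newton_kernel invfM.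
apply: measurable_funM => //.
apply: (measurableT_comp measurable_invsqrt).
have m1 : measurable_fun setT (fun p : RT3 * RT3 => p.1.1.1 - p.2.1.1 : RT).
  apply: measurable_funB; apply: measurableT_comp => //;
  exact: measurableT_comp.
have m2 : measurable_fun setT (fun p : RT3 * RT3 => p.1.1.2 - p.2.1.2 : RT).
  apply: measurable_funB; apply: measurableT_comp => //;
  exact: measurableT_comp.
have m3 : measurable_fun setT (fun p : RT3 * RT3 => p.1.2 - p.2.2 : RT).
  apply: measurable_funB; exact: measurableT_comp.
apply: measurable_funD; last exact: measurable_funX.
apply: measurable_funD; exact: measurable_funX.
Qed.

Lemma measurable_newton_kernel1 (y : RT3) :
  measurable_fun setT (fun x : RT3 => newton_kernel x y : RT).
Proof.
apply: (measurableT_comp measurable_newton_kernel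
  (f := fun p => newton_kernel p.1 p.2) (g := fun x : RT3 => (x, y))).
exact: measurable_fun_pair.
Qed.

Lemma measurable_newton_kernel2 (x : RT3) :
  measurable_fun setT (fun y : RT3 => newton_kernel x y : RT).
Proof.
apply: (measurableT_comp measurable_newton_kernel
  (f := fun p => newton_kernel p.1 p.2) (g := fun y : RT3 => (x, y))).
exact: measurable_fun_pair.
Qed.

(** Extension by zero moves the integral to the whole space, where Fubini is applied; the remaining
    [fine] is removed once integrability is known. *)
Lemma newtonianE (D : set (R3 R)) (f : R3 R -> R) (x : R3 R) :
  newtonian D f x =
  fine (\int[leb]_y ((f \_ D) y * newton_kernel x y)%:E)%E.
Proof.
rewrite /newtonian /Rintegral; congr fine.
rewrite -[LHS]/(\int[leb]_(y in D) (f y * newton_kernel x y)%:E)%E.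
rewrite [LHS]integral_mkcond.
apply: (@eq_integral _ _ _ leb setT) => y _; rewrite !patchE.
by case: ifP => // _; rewrite mul0r.
Qed.

Lemma measurable_newton_integrand (G E : RT3 -> RT) :
  measurable_fun setT G -> measurable_fun setT E ->
  measurable_fun setT
    (fun p : RT3 * RT3 => (G p.1 * E p.2 * newton_kernel p.1 p.2)%:E).
Proof.
move=> mG mE; apply/measurable_EFinP.
apply: measurable_funM; last exact: measurable_newton_kernel.
apply: measurable_funM.
  exact: (measurableT_comp mG).
exact: (measurableT_comp mE).
Qed.

Lemma integral_bounded_kernel (z : RT3) (a C : R) (G : RT3 -> RT) (y : RT3) :
    0 < a -> measurable_fun setT G ->
    (forall x, `|G x : R| <= if x \in ball3 z a then C else 0) -> y <> z ->
  (\int[leb]_x `|(G x * newton_kernel x y)%:E| <= (C * (a ^+ 2 / 2))%:E)%E.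
Proof.
move=> a0 mG GC yz.
have mD := measurable_ball3 z a0.
have mK := measurable_newton_kernel1 y.
(* The centre belongs to the ball, so the bound on [G] there forces [C] to be nonnegative. *)
have C0 : 0 <= C.
  have := GC z; rewrite mem_set; first by apply: le_trans; exact: normr_ge0.
  by rewrite /ball3/= /dist3 !subrr expr0n !addr0 sqrtr0.
apply: (@le_trans _ _ (\int[leb]_(x in ball3 z a) (C%:E * (newton_kernel y x)%:E))%E).
  rewrite [leRHS]integral_mkcond; apply: ge0_le_integral => //.
  - apply: measurableT_comp => //; apply/measurable_EFinP.
    exact: measurable_funM.
  - apply/(measurable_restrictT _ _).1 => //; apply: measurable_funTS.
    apply: measurable_funeM; apply/measurable_EFinP.
    exact: measurable_newton_kernel2.
  move=> x _; rewrite patchE /=.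
  rewrite normrM (ger0_norm (newton_kernel_ge0 _ _)).
  have := GC x; case: ifP => xD Gx.
    by rewrite -EFinM lee_fin newton_kernelC ler_wpM2r// newton_kernel_ge0.
  have /eqP -> : `|G x : R| == 0 by rewrite eq_le Gx normr_ge0.
  by rewrite mul0r.
rewrite ge0_integralZl_EFin//; last 2 first.
- by move=> x _; rewrite lee_fin newton_kernel_ge0.
- apply: measurable_funTS; apply/measurable_EFinP.
  exact: measurable_newton_kernel2.
by rewrite EFinM lee_wpmul2l//; exact: ge0_newton_kernel_bound.
Qed.

(** Integrating over the bounded factor [G] first absorbs the singularity of the kernel into the
    constant [C * (a ^+ 2 / 2)], for every [y] but the centre, and leaves the integrable function
    [E]. *)
Lemma integrable_newton_integrand (z : RT3) (a C : R) (G E : RT3 -> RT) :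
    0 < a -> measurable_fun setT G ->
    (forall x, `|G x : R| <= if x \in ball3 z a then C else 0) ->
    leb.-integrable setT (EFin \o E) ->
  (leb \x leb)%E.-integrable setT
    (fun p => (G p.1 * E p.2 * newton_kernel p.1 p.2)%:E).
Proof.
move=> a0 mG GC iE.
have mE : measurable_fun setT E by apply/measurable_EFinP; exact: measurable_int iE.
have mPhi := measurable_newton_integrand mG mE.
have C0 : 0 <= C.
  have := GC z; rewrite mem_set; first by apply: le_trans; exact: normr_ge0.
  by rewrite /ball3/= /dist3 !subrr expr0n !addr0 sqrtr0.
apply: (integrable21ltyP leb leb mPhi).2.
apply: (@le_lt_trans _ _
    (\int[leb]_y ((C * (a ^+ 2 / 2))%:E * `|(E y)%:E|))%E); last first.
  rewrite ge0_integralZl_EFin//.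
  - have /integrableP[_ ilt] := iE; apply: lte_mul_pinfty => //.
    by rewrite lee_fin mulr_ge0// divr_ge0// sqr_ge0.
  - by apply: measurableT_comp => //; apply/measurable_EFinP.
  - by rewrite mulr_ge0// divr_ge0// sqr_ge0.
have mabs : measurable_fun setT (fun p : RT3 * RT3 =>
    `|(G p.1 * E p.2 * newton_kernel p.1 p.2)%:E|)%E.
  exact: measurableT_comp.
apply: ae_ge0_le_integral => //.
- by move=> y _; exact: integral_ge0.
- exact: (measurable_fun_fubini_tonelli_G (m1 := leb) _ mabs).
- by move=> y _; rewrite mule_ge0// lee_fin mulr_ge0// divr_ge0// sqr_ge0.
- apply: measurable_funeM; apply: measurableT_comp => //.
  exact/measurable_EFinP.
exists [set z]; split=> //.
- exact: measurable_set1_3.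
- exact: leb3_set1.
move=> y /=; apply: contra_notP => yz _.
rewrite (_ : integral _ _ _ = (\int[leb]_x
    (`|E y|%:E * `|(G x * newton_kernel x y)%:E|))%E); last first.
  apply: eq_integral => x _; rewrite /= -EFinM -normrM; congr (`|_|%:E).
  by ring.
rewrite ge0_integralZl_EFin//; last first.
  apply: measurableT_comp => //; apply/measurable_EFinP.
  apply: measurable_funM => //.
  exact: measurable_newton_kernel1.
rewrite muleC lee_wpmul2r//.
by apply: integral_bounded_kernel yz.
Qed.

End newton_operator.

(** * Eigenvalues with an eigenfunction of nonzero mean *)

Section spectrum.
Context {R : realType}.
Local Notation mu := (@lebesgue_measure R).
Local Notation RT := (measurableTypeR R).
Local Notation RT3 := (RT * RT * RT)%type.
Local Notation leb := (sf_leb3 R).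

Lemma measurable_sinc_ball (k : R) (z : RT3) :
  measurable_fun setT (fun y : RT3 => sinc_sqrt k (sqd3 y z) : RT).
Proof. exact: (measurableT_comp (measurable_sinc_sqrt k) (measurable_sqd3 z)). Qed.

Lemma mean_eigenvalue_sinc (k a : R) (z : R3 R) : 0 < k -> 0 < a ->
  cos (k * a) = 0 -> mean_eigenvalue (ball3 z a) (k ^- 2).
Proof.
move=> k0 a0 cka; have mD := measurable_ball3 z a0.
exists (fun y => sinc_sqrt k (sqd3 y z)); split.
- split; first by apply: measurable_funTS; exact: measurable_sinc_ball.
  apply: (@le_lt_trans _ _ (\int[leb]_(y in ball3 z a) (k ^+ 2)%:E)%E).
    apply: ge0_le_integral => //.
    + by move=> y _; rewrite lee_fin sqr_ge0.
    + apply: measurable_funTS; apply/measurable_EFinP; apply: measurable_funX.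
      exact: measurable_sinc_ball.
    + move=> y _; rewrite lee_fin -[leLHS]real_normK ?num_real//.
      rewrite ler_pXn2r// ?nnegrE ?normr_ge0 ?(ltW k0)//.
      by rewrite norm_sinc_sqrt_le// ltW.
  rewrite integral_cst//; apply: lte_mul_pinfty => //.
    by rewrite lee_fin sqr_ge0.
  exact: leb3_ball3_lty.
- exists [set z]; split; [exact: measurable_set1_3|exact: leb3_set1|].
  move=> x /=; apply: contra_notP => xz xD.
  by rewrite newtonian_sinc// cka mul0r subr0 mulrC.
- rewrite Rintegral_sinc_ball// cka mulr0 mul0r subr0.
  (* Sine and cosine have no common zero. *)
  have s0 : sin (k * a) != 0.
    apply/eqP => s0; have := cos2Dsin2 (k * a).
    by rewrite cka s0 !expr0n addr0 => /eqP; rewrite eq_sym oner_eq0.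
  by rewrite !mulf_neq0// ?invr_eq0 ?expf_neq0 ?gt_eqF ?pi_gt0.
Qed.

Lemma integrable_L2 (D : set RT3) (e : RT3 -> RT) : measurable D ->
  (leb D < +oo)%E -> L2on leb D e -> leb.-integrable setT (EFin \o (e \_ D)).
Proof.
move=> mD Doo [me e2]; have mE : measurable_fun setT (e \_ D).
  exact/(measurable_restrictT _ _).1.
apply/integrableP; split; first exact/measurable_EFinP.
have me2 : measurable_fun D (fun x => (e x ^+ 2)%:E).
  by apply/measurable_EFinP; exact: measurable_funX.
apply: (@le_lt_trans _ _ (\int[leb]_(x in D) (1%:E + (e x ^+ 2)%:E))%E).
  rewrite [leRHS]integral_mkcond; apply: ge0_le_integral => //.
  - by apply: measurableT_comp => //; exact/measurable_EFinP.
  - by apply/(measurable_restrictT _ _).1 => //; exact: emeasurable_funD.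
  - move=> x _; rewrite /= !patchE; case: ifP => _; last first.
      by rewrite normr0.
    (* On a set of finite measure [|e| <= 1 + e ^+ 2] gives L^1 from L^2; the inequality follows
       from [(|e| - 1) ^+ 2 >= 0]. *)
    rewrite lee_fin; have := sqr_ge0 (`|e x : R| - 1).
    rewrite sqrrB1 real_normK ?num_real//.
    have := normr_ge0 (e x : R); lra.
rewrite ge0_integralD//; last by move=> x _; rewrite lee_fin sqr_ge0.
by rewrite integral_cst// mul1e; apply: lte_add_pinfty.
Qed.

(** The double integral of [Phi] is evaluated in both orders. Integrating over [y] first uses the
    eigenvalue equation, over [x] first the explicit potential of [G]; the two results differ by
    [cos (k * a) / k] times the mean of [E]. *)
Lemma mean_eigenvalue_cos (k a : R) (z : R3 R) : 0 < k -> 0 < a ->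
  mean_eigenvalue (ball3 z a) (k ^- 2) -> cos (k * a) = 0.
Proof.
move=> k0 a0 [e [L2e Ne e0]]; have mD := measurable_ball3 z a0.
have Doo := leb3_ball3_lty z a0.
have iE := integrable_L2 mD Doo L2e.
set D := ball3 z a in mD Doo iE L2e Ne e0 *.
pose E : RT3 -> RT := e \_ D.
pose s (y : RT3) : RT := sinc_sqrt k (sqd3 y z).
pose G : RT3 -> RT := s \_ D.
have mE : measurable_fun setT E.
  by apply/measurable_EFinP; exact: measurable_int iE.
have ms : measurable_fun setT s by exact: measurable_sinc_ball.
have mG : measurable_fun setT G.
  by apply/(measurable_restrictT _ _).1 => //; exact: measurable_funTS.
have sk x : `|s x : R| <= k by rewrite norm_sinc_sqrt_le// ltW.
have GC x : `|G x : R| <= if x \in D then k else 0.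
  by rewrite /G patchE; case: ifP => // _; rewrite normr0.
(* [G] may vanish inside the ball, so integrability of [Phi] does not control every slice of [E]
   against the kernel. With the indicator in place of [G], almost every slice over [D] is
   integrable, so [newtonian D e x] is a genuine integral there. *)
pose I : RT3 -> RT := \1_D.
have mI : measurable_fun setT I by exact: measurable_indic.
have IC x : `|I x : R| <= if x \in D then 1 else 0.
  by rewrite /I indicE; case: (x \in D); rewrite ?normr1 ?normr0.
pose Phi (p : RT3 * RT3) := (G p.1 * E p.2 * newton_kernel p.1 p.2)%:E.
have iPhi : (leb \x leb)%E.-integrable setT Phi.
  exact: (integrable_newton_integrand a0 mG GC iE).
have iPsi := integrable_newton_integrand a0 mI IC iE.
have iGE : leb.-integrable setT (EFin \o (fun x => G x * E x)).
  apply: (@le_integrable _ _ _ leb setT _ _ (fun x => (k%:E * (E x)%:E)%E)) => //.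
  - by apply/measurable_EFinP; exact: measurable_funM.
  - move=> x _; rewrite /= lee_fin !normrM ler_wpM2r//.
    rewrite (ger0_norm (ltW k0)); apply: le_trans (GC x) _.
    by case: ifP => // _; exact: ltW.
  - exact: integrableZl.
have LHS : (\int[leb]_x \int[leb]_y Phi (x, y) =
    \int[leb]_x (k ^- 2 * (G x * E x))%:E)%E.
  apply: ae_eq_integral => //.
  - exact: measurable_int (integrable_fubini_F iPhi).
  - apply/measurable_EFinP; apply: measurable_funM => //.
    exact: measurable_funM.
  have Ne' : {ae leb, forall x, D x -> newtonian D e x = k ^- 2 * e x} := Ne.
  have aei := ae_integrable1 iPsi.
  have Fae := ae_filter_ringOfSetsType leb.
  apply: (filterS2 _ _ Ne' aei) => x Nx iy _.
  have [xD|xD] := boolP (x \in D); last first.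
    rewrite /G patchE (negbTE xD) mul0r mulr0.
    by rewrite integral0_eq// => y _; rewrite /Phi/= /G patchE (negbTE xD) !mul0r.
  have Ex : (\int[leb]_y (E y * newton_kernel x y)%:E)%E = (k ^- 2 * E x)%:E.
    rewrite /E [in RHS]patchE xD -(Nx (set_mem xD)) newtonianE fineK//.
    apply: integrable_fin_num => //.
    by move: iy; rewrite /I /= indicE xD; under eq_fun do rewrite mul1r.
  rewrite (_ : integral _ _ _ = (\int[leb]_y ((G x)%:E * (E y * newton_kernel x y)%:E))%E); last first.
    by apply: eq_integral => y _; rewrite /Phi/= -EFinM mulrA.
  rewrite integralZl//; last first.
    by move: iy; rewrite /I /= indicE xD; under eq_fun do rewrite mul1r.
  by rewrite Ex -EFinM; congr EFin; rewrite mulrCA.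
have RHS : (\int[leb]_y \int[leb]_x Phi (x, y) =
    \int[leb]_y (k ^- 2 * (G y * E y) - cos (k * a) / k * E y)%:E)%E.
  apply: ae_eq_integral => //.
  - exact: (measurable_fubini_G iPhi).
  - apply/measurable_EFinP; apply: measurable_funB.
      apply: measurable_funM => //.
      exact: measurable_funM.
    exact: measurable_funM.
  exists [set z]; split; [exact: measurable_set1_3|exact: leb3_set1|].
  move=> y /=; apply: contra_notP => yz _.
  have [yD|yD] := boolP (y \in D); last first.
    rewrite /E patchE (negbTE yD) !mulr0 subr0.
    by rewrite integral0_eq// => x _; rewrite /Phi/= /E patchE (negbTE yD) mulr0 mul0r.
  have iGK : leb.-integrable setT (fun x => (G x * newton_kernel y x)%:E).
    apply/integrableP; split.
      apply/measurable_EFinP; apply: measurable_funM => //.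
      exact: measurable_newton_kernel2.
    apply: (@le_lt_trans _ _ (k * (a ^+ 2 / 2))%:E); last exact: ltry.
    under eq_integral do rewrite newton_kernelC.
    exact: integral_bounded_kernel a0 mG GC yz.
  have Gy : (\int[leb]_x (G x * newton_kernel y x)%:E)%E =
      (s y / k ^+ 2 - cos (k * a) / k)%:E.
    rewrite -newtonian_sinc//; last exact: set_mem.
    rewrite newtonianE fineK//; exact: integrable_fin_num.
  rewrite (_ : integral _ _ _ = (\int[leb]_x ((E y)%:E * (G x * newton_kernel y x)%:E))%E); last first.
    apply: eq_integral => x _; rewrite /Phi/= -EFinM newton_kernelC.
    by congr EFin; ring.
  rewrite integralZl// Gy -EFinM; congr EFin.
  by rewrite /G patchE yD; ring.
have H : Rintegral leb setT (fun x => k ^- 2 * (G x * E x)) =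
    Rintegral leb setT (fun y => k ^- 2 * (G y * E y) - cos (k * a) / k * E y).
  by rewrite /Rintegral -LHS (Fubini iPhi) RHS.
have iZ (c : R) (f : RT3 -> RT) : leb.-integrable setT (EFin \o f) ->
    leb.-integrable setT (EFin \o (fun x => c * f x)).
  move=> fi; have := integrableZl measurableT c fi.
  by apply: eq_integrable => // x _ /=; rewrite EFinM.
have cE : cos (k * a) / k * Rintegral leb setT E = 0.
  move: H; rewrite RintegralB//; [|exact: iZ|exact: iZ].
  by rewrite [X in _ - X]RintegralZl// => H; lra.
have E0 : Rintegral leb setT E != 0.
  by move: e0; rewrite -[X in X != 0]/(Rintegral leb D e) Rintegral_mkcond.
move/eqP: cE; rewrite mulf_eq0 (negbTE E0) orbF mulf_eq0 invr_eq0.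
by rewrite (gt_eqF k0) orbF => /eqP.
Qed.

End spectrum.

(** * Enumeration of the eigenvalues *)

Section enumeration.
Context {R : realType}.

Lemma cos_addn_pi (x : R) n : cos (x + pi *+ n) = (-1) ^+ n * cos x.
Proof.
elim: n => [|n IH]; first by rewrite mulr0n addr0 expr0 mul1r.
by rewrite mulrSr addrA cosDpi IH exprSr mulrN1 mulNr.
Qed.

Lemma cos_eq0_pos (t : R) : 0 < t -> cos t = 0 ->
  exists n : nat, t = (n%:R + 2^-1) * pi.
Proof.
(* Removing [n] half-turns leaves a remainder in [[0, pi[], where the cosine is injective. *)
move=> t0 ct; have pi0 := pi_gt0 R; pose n := Num.trunc (t / pi).
have tpi : 0 <= t / pi by rewrite divr_ge0// ltW.
have /andP[n1 n2] := truncn_itv tpi.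
exists n; pose x := t - pi *+ n.
have x0 : 0 <= x by rewrite subr_ge0 -mulr_natl -ler_pdivlMr.
have xpi : x < pi.
  by rewrite ltrBlDr -mulrS -mulr_natl -ltr_pdivrMr.
have cx : cos x = 0.
  have := cos_addn_pi x n; rewrite subrK ct => /esym/eqP.
  by rewrite mulf_eq0 signr_eq0 => /eqP.
have xE : x = pi / 2.
  apply: cos_inj; rewrite ?cx ?cos_pihalf//.
  - by rewrite in_itv/= x0 ltW.
  - by rewrite in_itv/=; apply/andP; split; lra.
have -> : t = pi / 2 + pi *+ n by rewrite -xE subrK.
by rewrite -mulr_natl; ring.
Qed.

Lemma cos_half_odd_pi n : cos ((n%:R + 2^-1) * pi) = 0 :> R.
Proof.
have -> : (n%:R + 2^-1) * pi = pi / 2 + pi *+ n :> R by rewrite -mulr_natl; ring.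
by rewrite cos_addn_pi cos_pihalf mulr0.
Qed.

(** If [u n = v j] then [n <= j], because the indices of [u 0, u 1, ...] within [v] strictly
    increase. Applied in both directions, it shows that two strictly decreasing sequences with the
    same values coincide. *)
Lemma decreasing_subseq_le (u v : nat -> R) :
  (forall m n, (m < n)%N -> u n < u m) -> (forall m n, (m < n)%N -> v n < v m) ->
  (forall n, exists j, u n = v j) -> forall n, u n <= v n.
Proof.
move=> du dv uv; have vle i j : (i <= j)%N -> v j <= v i.
  by rewrite leq_eqVlt => /predU1P[->//|/dv/ltW].
have idx n j : u n = v j -> (n <= j)%N.
  elim: n j => // n IH j uj; have [j' uj'] := uv n.
  apply: leq_ltn_trans (IH _ uj') _; rewrite ltnNge; apply/negP => /vle.
  by rewrite -uj -uj' leNgt du.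
by move=> n; have [j uj] := uv n; rewrite uj vle// idx.
Qed.

Lemma mean_eigenvalues_enum (z : R3 R) (a : R) (lam : nat -> R) : 0 < a ->
  (forall m n : nat, (m < n)%N -> lam n < lam m) ->
  range lam = [set l | mean_eigenvalue (ball3 z a) l] ->
  forall n, lam n = ((n%:R + 2^-1) * pi / a) ^- 2.
Proof.
move=> a0 dlam rlam; have pi0 := pi_gt0 R.
pose k (n : nat) : R := (n%:R + 2^-1) * pi / a.
have k0 n : 0 < k n by rewrite !mulr_gt0 ?invr_gt0// ltr_wpDl.
have ka n : k n * a = (n%:R + 2^-1) * pi by rewrite divfK ?gt_eqF.
pose m (n : nat) : R := k n ^- 2.
have m0 n : 0 < m n by rewrite invr_gt0 exprn_gt0.
have dm i j : (i < j)%N -> m j < m i.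
  move=> ij; rewrite ltf_pV2 ?posrE ?exprn_gt0// ltrXn2r// ?nnegrE ?ltW//.
  by rewrite !ltr_pM2r ?invr_gt0// ltrD2r ltr_nat.
have mlam n : exists j, m n = lam j.
  have : range lam (m n).
    by rewrite rlam; apply: mean_eigenvalue_sinc => //; rewrite ka cos_half_odd_pi.
  by move=> [j _ <-]; exists j.
have ml := decreasing_subseq_le dm dlam mlam.
have lamm n : exists j, lam n = m j.
  (* One comparison already bounds [lam n] below by a positive number, so it can be written [q ^- 2]
     before the other one is proved. *)
  have l0 : 0 < lam n by exact: lt_le_trans (ml n).
  have : range lam (lam n) by exists n.
  pose q := (Num.sqrt (lam n))^-1.
  have q0 : 0 < q by rewrite invr_gt0 sqrtr_gt0.
  have lq : lam n = q ^- 2 by rewrite exprVn invrK sqr_sqrtr// ltW.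
  rewrite rlam /= lq => /(mean_eigenvalue_cos q0 a0) /cos_eq0_pos[|j qa].
    exact: mulr_gt0.
  by exists j; rewrite /m /k -qa mulfK ?gt_eqF.
move=> n; apply: le_anti; rewrite ml andbT.
exact: (decreasing_subseq_le dlam dm lamm).
Qed.

End enumeration.

(** * Half-integer trigonometric sums *)

Section half_integer_trig.
Context {R : realType}.
Variable L : R.
Hypothesis L0 : 0 < L.

Definition half_freq (n : nat) : R := (n%:R + 2^-1) * pi / L.

Definition is_comb (f : R -> R) := exists M c d, f = sincos_comb half_freq M c d.

Lemma sincos_comb_widen M K (c d : nat -> R) : (M <= K)%N ->
  sincos_comb half_freq M c d =
  sincos_comb half_freq K (fun n => if (n < M)%N then c n else 0)
                          (fun n => if (n < M)%N then d n else 0).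
Proof.
move=> MK; apply/funext => t; rewrite /sincos_comb.
rewrite (big_ord_widen K (fun n => c n * sin (half_freq n * t) +
  d n * cos (half_freq n * t)) MK) big_mkcond; apply: eq_bigr => n _ /=.
by case: ifP => // _; rewrite !mul0r addr0.
Qed.

Lemma is_combD f g : is_comb f -> is_comb g -> is_comb (fun t => f t + g t).
Proof.
move=> [M [c [d ->]]] [K [c' [d' ->]]].
rewrite (sincos_comb_widen c d (leq_maxl M K)).
rewrite (sincos_comb_widen c' d' (leq_maxr M K)).
exists (maxn M K),
  (fun n => (if (n < M)%N then c n else 0) + (if (n < K)%N then c' n else 0)),
  (fun n => (if (n < M)%N then d n else 0) + (if (n < K)%N then d' n else 0)).
apply/funext => t; rewrite /sincos_comb -big_split/=; apply: eq_bigr => n _.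
by ring.
Qed.

Lemma is_combZ (a : R) f : is_comb f -> is_comb (fun t => a * f t).
Proof.
move=> [M [c [d ->]]]; exists M, (fun n => a * c n), (fun n => a * d n).
apply/funext => t; rewrite /sincos_comb big_distrr/=; apply: eq_bigr => n _.
by ring.
Qed.

Lemma is_comb0 : is_comb (fun _ => 0).
Proof.
by exists 0%N, (fun _ => 0), (fun _ => 0); apply/funext => t; rewrite /sincos_comb big_ord0.
Qed.

Lemma is_comb_sum M (f : nat -> R -> R) : (forall n, is_comb (f n)) ->
  is_comb (fun t => \sum_(n < M) f n t).
Proof.
move=> cf; elim: M => [|M IH].
  rewrite (_ : (fun t => _) = fun _ => 0); first exact: is_comb0.
  by apply/funext => t; rewrite big_ord0.
rewrite (_ : (fun t => _) = fun t => \sum_(n < M) f n t + f M t).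
  exact: is_combD.
by apply/funext => t; rewrite big_ord_recr.
Qed.

(** The phase form treats sines and cosines alike in the product formulas. *)
Lemma is_comb_phase n (b : R) : is_comb (fun t => sin (half_freq n * t + b)).
Proof.
exists n.+1, (fun m => if m == n then cos b else 0),
  (fun m => if m == n then sin b else 0).
apply/funext => t; rewrite /sincos_comb big_ord_recr/= eqxx big1 => [|i _].
  by rewrite add0r sinD mulrC [sin b * _]mulrC.
by rewrite ltn_eqF// !mul0r addr0.
Qed.

Lemma half_freqS n : half_freq n.+1 = half_freq n + pi / L.
Proof. by rewrite /half_freq -natr1; field; exact: lt0r_neq0. Qed.

Lemma sin_mul_cos (x y : R) :
  sin x * cos y = 2^-1 * sin (x + y) + 2^-1 * sin (x - y).
Proof. by rewrite sinD sinB; field. Qed.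

(** By product-to-sum, multiplication by a cosine of frequency [pi / L] shifts the index by one, up
    and down. *)
Lemma is_comb_mul_cos f (g : R) : is_comb f ->
  is_comb (fun t => f t * cos (pi / L * t + g)).
Proof.
have phase n b : is_comb (fun t => sin (half_freq n * t + b) * cos (pi / L * t + g)).
  have -> : (fun t => sin (half_freq n * t + b) * cos (pi / L * t + g)) =
      (fun t => 2^-1 * sin (half_freq n.+1 * t + (b + g)) +
                2^-1 * sin (half_freq n * t + b - (pi / L * t + g))).
    apply/funext => t.
    have -> : half_freq n.+1 * t + (b + g) =
        (half_freq n * t + b) + (pi / L * t + g) by rewrite half_freqS; ring.
    exact: sin_mul_cos.
  apply: is_combD; apply: is_combZ; first exact: is_comb_phase.
  (* At index 0 the lowered frequency is [- half_freq 0], and the sine being odd brings it back to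
     index 0. *)
  case: n => [|n].
    have -> : (fun t => sin (half_freq 0 * t + b - (pi / L * t + g))) =
        (fun t => - 1 * sin (half_freq 0 * t + (g - b))).
      apply/funext => t; rewrite mulN1r -sinN; congr sin.
      rewrite /half_freq add0r; move: (pi : R) => p.
      by field; exact: lt0r_neq0.
    by apply: is_combZ; exact: is_comb_phase.
  have -> : (fun t => sin (half_freq n.+1 * t + b - (pi / L * t + g))) =
      (fun t => sin (half_freq n * t + (b - g))).
    by apply/funext => t; congr sin; rewrite half_freqS; ring.
  exact: is_comb_phase.
move=> [M [c [d ->]]].
have -> : (fun t => sincos_comb half_freq M c d t * cos (pi / L * t + g)) =
    (fun t => \sum_(n < M)
      (c n * (sin (half_freq n * t + 0) * cos (pi / L * t + g)) +
       d n * (sin (half_freq n * t + pi / 2) * cos (pi / L * t + g)))).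
  apply/funext => t; rewrite /sincos_comb big_distrl/=; apply: eq_bigr => n _.
  by rewrite addr0 sinDpihalf; ring.
apply: (@is_comb_sum M (fun n t =>
  (c n * (sin (half_freq n * t + 0) * cos (pi / L * t + g)) +
   d n * (sin (half_freq n * t + pi / 2) * cos (pi / L * t + g))))) => n.
by apply: is_combD; exact: is_combZ.
Qed.

(** A translate of the sine of lowest frequency. Its half-period [2 * L] is the length of the
    interval, so for [al] in it the sign on the open interval is that of [t - al]. *)
Definition half_sin (al t : R) : R := sin (pi / (2 * L) * (t - al)).

(** Induction on [P]: the square of [half_sin] is [(1 - cos) / 2] with a cosine of frequency
    [pi / L], so multiplying by it preserves combinations. *)
Lemma is_comb_poly (P : {poly R}) (al : R) :
  is_comb (fun t => P.[half_sin al t ^+ 2] * half_sin al t).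
Proof.
have E0 : half_sin al =
    (fun t => sin (half_freq 0 * t + - (pi / (2 * L) * al))).
  apply/funext => t; rewrite /half_sin; congr sin; rewrite /half_freq add0r.
  by move: (pi : R) => p; field; exact: lt0r_neq0.
have E2 t : half_sin al t ^+ 2 =
    2^-1 - 2^-1 * cos (pi / L * t + - (pi / L * al)).
  have -> : pi / L * t + - (pi / L * al) = (pi / (2 * L) * (t - al)) *+ 2.
    by rewrite -mulr_natl; field; exact: lt0r_neq0.
  rewrite /half_sin; move: (pi / (2 * L) * (t - al)) => x.
  by rewrite cos_mulr2n cos2sin2 mulr2n; field.
elim/poly_ind: P => [|P c IH].
  rewrite (_ : (fun t => _) = fun _ => 0); first exact: is_comb0.
  by apply/funext => t; rewrite horner0 mul0r.
have -> : (fun t => (P * 'X + c%:P).[half_sin al t ^+ 2] * half_sin al t) =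
  (fun t => (2^-1 * (P.[half_sin al t ^+ 2] * half_sin al t) +
     - 2^-1 * ((P.[half_sin al t ^+ 2] * half_sin al t) *
        cos (pi / L * t + - (pi / L * al)))) + c * half_sin al t).
  apply/funext => t; rewrite hornerD hornerM hornerX hornerC.
  by rewrite {2}E2; ring.
apply: is_combD; last by apply: is_combZ; rewrite E0; exact: is_comb_phase.
apply: is_combD; first exact: is_combZ.
by apply: is_combZ; exact: is_comb_mul_cos.
Qed.

End half_integer_trig.

(** * Polynomial approximation of the sign *)

Section sign_iteration.
Context {R : realType}.

(* [y * (sign_poly n).[y ^+ 2]] is the [n]-th iterate of the odd polynomial
   [(3 y - y ^+ 3) / 2], which tends to the sign of [y] on [-1, 1]. *)
Fixpoint sign_poly (n : nat) : {poly R} :=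
  if n is m.+1 then
    2^-1 *: (sign_poly m * (3%:P - 'X * sign_poly m ^+ 2)) else 1.

Definition sign_iter (n : nat) (y : R) : R := (sign_poly n).[y ^+ 2] * y.

Lemma sign_iterS n y : sign_iter n.+1 y =
  2^-1 * (sign_iter n y * (3 - sign_iter n y ^+ 2)).
Proof.
by rewrite /sign_iter/= hornerZ hornerM hornerD hornerN hornerM hornerX
  horner_exp hornerC; ring.
Qed.

Lemma sign_iterN n y : sign_iter n (- y) = - sign_iter n y.
Proof. by rewrite /sign_iter sqrrN mulrN. Qed.

Lemma sign_iter_itv n y : 0 <= y <= 1 -> y <= sign_iter n y <= 1.
Proof.
move=> y01; elim: n => [|n /andP[IH1 IH2]].
  by rewrite /sign_iter/= hornerC mul1r lexx; case/andP: y01.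
rewrite sign_iterS; move: (sign_iter n y) IH1 IH2 => q q1 q2.
case/andP: y01 => y0 y1; apply/andP; split; first by nra.
(* This product is twice [1 - q * (3 - q ^+ 2) / 2]. *)
have : 0 <= (1 - q) ^+ 2 * (2 + q) by rewrite mulr_ge0 ?sqr_ge0//; lra.
by nra.
Qed.

Lemma norm_sign_iter_le1 n y : `|y| <= 1 -> `|sign_iter n y| <= 1.
Proof.
wlog y0 : y / 0 <= y.
  move=> H y1; have [/H->//|/ltW y0] := leP 0 y.
  by rewrite -normrN -sign_iterN H ?oppr_ge0// normrN.
rewrite (ger0_norm y0) => y1.
have y01 : 0 <= y <= 1 by rewrite y0.
have /andP[h1 h2] := sign_iter_itv n y01.
by rewrite ger0_norm// (le_trans y0).
Qed.

(** The iterates stay above [y], so each step multiplies the distance to 1 by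
    [(2 - q - q ^+ 2) / 2 <= 1 - y / 2]. *)
Lemma sign_iter_cvg1 y : 0 < y <= 1 -> sign_iter n y @[n --> \oo] --> (1 : R).
Proof.
move=> /andP[y0 y1].
have bnd n : 1 - (1 - y / 2) ^+ n <= sign_iter n y <= 1.
  have itv k := @sign_iter_itv k y.
  have {}itv k : y <= sign_iter k y <= 1 by apply: itv; rewrite (ltW y0).
  have /andP[_ ->] := itv n; rewrite andbT.
  elim: n => [|n IH]; first by have /andP[h _] := itv 0%N; rewrite expr0; lra.
  rewrite sign_iterS exprS; move: (itv n) IH.
  move: (sign_iter n y) => q /andP[q1 q2] IH.
  set e := (1 - y / 2) ^+ n in IH *.
  have q' : 1 - 2^-1 * (q * (3 - q ^+ 2)) = (1 - q) * ((2 - q - q ^+ 2) / 2).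
    by field.
  have H1 : (1 - q) * ((2 - q - q ^+ 2) / 2) <= (1 - q) * (1 - y / 2).
    by apply: ler_wpM2l; [lra|have := sqr_ge0 q; lra].
  have H2 : (1 - q) * (1 - y / 2) <= e * (1 - y / 2) by apply: ler_wpM2r; lra.
  by rewrite mulrC; lra.
apply: (@squeeze_cvgr _ _ _ _ (fun n => 1 - (1 - y / 2) ^+ n) (fun=> 1)).
- by apply: nearW => n; exact: bnd.
- rewrite -[X in _ --> X]subr0; apply: cvgB; first exact: cvg_cst.
  by apply: cvg_expr; rewrite ger0_norm; lra.
- exact: cvg_cst.
Qed.

Lemma sign_iter_cvgN1 y : -1 <= y < 0 -> sign_iter n y @[n --> \oo] --> (- 1 : R).
Proof.
move=> y0; rewrite (_ : (fun n => _) = fun n => - sign_iter n (- y)).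
  by apply: cvgN; apply: sign_iter_cvg1; lra.
by apply/funext => n; rewrite sign_iterN opprK.
Qed.

End sign_iteration.

(** * Orthogonality of the sines and cosines *)

Section orthogonality.
Context {R : realType}.
Local Notation mu := (@lebesgue_measure R).
Variable L : R.
Hypothesis L0 : 0 < L.
Local Notation w := (half_freq L).

Lemma sin_mulrn_pi n : sin (pi *+ n) = 0 :> R.
Proof.
elim: n => [|n IH]; first by rewrite mulr0n sin0.
by rewrite mulrSr sinDpi IH oppr0.
Qed.

(** Two half-odd multiples of [pi / L] add up to an integer multiple. *)
Lemma sin_freqD i j : sin ((w i + w j) * L) = 0.
Proof.
have -> : (w i + w j) * L = pi *+ (i + j).+1.
  have e : (i + j).+1%:R = i%:R + j%:R + 1 :> R by rewrite -addn1 !natrD.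
  rewrite /half_freq -(mulr_natl pi) e; move: (pi : R) => p.
  by field; exact: lt0r_neq0.
exact: sin_mulrn_pi.
Qed.

Lemma sin_freqB i j : sin ((w i - w j) * L) = 0.
Proof.
wlog ji : i j / (j <= i)%N.
  move=> H; have [/H//|/ltnW/H ij] := leqP j i.
  by rewrite -opprB mulNr sinN ij oppr0.
have -> : (w i - w j) * L = pi *+ (i - j).
  rewrite /half_freq -(mulr_natl pi) natrB//; move: (pi : R) => p.
  by field; exact: lt0r_neq0.
exact: sin_mulrn_pi.
Qed.

Lemma is_derive_trig_antiderivative (A B x t : R) : x != 0 ->
  is_derive t (1 : R) (fun t : R => x^-1 * (A * sin (x * t) - B * cos (x * t)))
    (A * cos (x * t) + B * sin (x * t)).
Proof.
move=> x0; have dx : is_derive t (1 : R) (fun t : R => x * t) (x *: (1 : R)).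
  exact: is_deriveZ.
have ds := @is_derive1_comp _ sin (fun t : R => x * t) t _ _ (is_derive_sin _) dx.
have dc := @is_derive1_comp _ cos (fun t : R => x * t) t _ _ (is_derive_cos _) dx.
apply: (is_derive_eq (is_deriveZ x^-1 (is_deriveB (is_deriveZ A ds) (is_deriveZ B dc)))).
by rewrite /GRing.scale/=; field.
Qed.

(** Providing antiderivatives instead of integrals lets the square of a whole sum be integrated by a
    single use of [integral_FTC]. By product-to-sum, [A] and [C] go with the difference of the
    frequencies, [B] and [E] with their sum. *)
Lemma product_antiderivative (c d c' d' : R) (i j : nat) : exists F : R -> R,
  (forall t : R, is_derive t (1 : R) F
    ((c * sin (w i * t) + d * cos (w i * t)) *
     (c' * sin (w j * t) + d' * cos (w j * t)))) /\
  F L - F (- L) = if i == j then L * (c * c' + d * d') else 0.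
Proof.
pose U x A B (t : R) := x^-1 * (A * sin (x * t) - B * cos (x * t)).
have UL x A B : sin (x * L) = 0 -> U x A B L - U x A B (- L) = 0.
  by move=> s0; rewrite /U mulrN sinN cosN s0; ring.
have dU x A B t : x != 0 ->
  is_derive t (1 : R) (U x A B) (A * cos (x * t) + B * sin (x * t)).
  exact: is_derive_trig_antiderivative.
have wD : w i + w j != 0.
  by rewrite gt_eqF// addr_gt0// !mulr_gt0 ?invr_gt0 ?pi_gt0// ltr_wpDl.
pose A := (c * c' + d * d') / 2; pose B := (d * d' - c * c') / 2.
pose C := (c * d' - d * c') / 2; pose E := (c * d' + d * c') / 2.
have prod t : (c * sin (w i * t) + d * cos (w i * t)) *
     (c' * sin (w j * t) + d' * cos (w j * t)) =
     (A * cos ((w i - w j) * t) + C * sin ((w i - w j) * t)) +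
     (B * cos ((w i + w j) * t) + E * sin ((w i + w j) * t)).
  rewrite (mulrBl t) (mulrDl (w i)) sinB sinD cosB cosD /A /B /C /E.
  by field.
(* On the diagonal the difference frequency is 0: its cosine integrates to the linear term [A * t],
   the only one with a nonzero increment. *)
have [ij|ij] := eqVneq i j.
  exists (fun t => A * t + U (w i + w j) B E t); split=> [t|].
    have dA : is_derive t (1 : R) (fun t : R => A * t) (A *: (1 : R)).
      exact: is_deriveZ.
    apply: (is_derive_eq (is_deriveD dA (dU _ B E t wD))).
    rewrite prod ij subrr mul0r cos0 sin0 /C /GRing.scale/=; ring.
  have -> : A * L + U (w i + w j) B E L - (A * - L + U (w i + w j) B E (- L)) =
    2 * (A * L) + (U (w i + w j) B E L - U (w i + w j) B E (- L)) by ring.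
  by rewrite UL ?sin_freqD// /A; field.
have wB : w i - w j != 0.
  have pi0 : pi != 0 :> R by rewrite gt_eqF// pi_gt0.
  have Li0 : L^-1 != 0 by rewrite invr_eq0 gt_eqF.
  rewrite subr_eq0 /half_freq (inj_eq (mulIf Li0)) (inj_eq (mulIf pi0)).
  by rewrite (inj_eq (addIr _)) eqr_nat.
exists (fun t => U (w i - w j) A C t + U (w i + w j) B E t); split=> [t|].
  by rewrite prod; exact: (is_deriveD (dU _ A C t wB) (dU _ B E t wD)).
have -> : U (w i - w j) A C L + U (w i + w j) B E L -
  (U (w i - w j) A C (- L) + U (w i + w j) B E (- L)) =
  (U (w i - w j) A C L - U (w i - w j) A C (- L)) +
  (U (w i + w j) B E L - U (w i + w j) B E (- L)) by ring.
by rewrite !UL ?sin_freqD ?sin_freqB// addr0.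
Qed.

Lemma continuous_sincos_comb M (c d : nat -> R) :
  continuous (sincos_comb w M c d).
Proof.
have cp (x y z : R) : continuous (fun t : R => y * sin (x * t) + z * cos (x * t)).
  move=> t; have cx : {for t, continuous (fun t : R => x * t)}.
    by apply: cvgM; [exact: cvg_cst|exact: cvg_id].
  apply: cvgD; apply: cvgM; try exact: cvg_cst.
    by apply: continuous_comp; [exact: cx|exact: continuous_sin].
  by apply: continuous_comp; [exact: cx|exact: continuous_cos].
elim: M => [|M IH] t.
  rewrite (_ : sincos_comb w 0 c d = fun _ => 0); first exact: cvg_cst.
  by apply/funext => u; rewrite /sincos_comb big_ord0.
rewrite (_ : sincos_comb w M.+1 c d = fun t => sincos_comb w M c d t +
    (c M * sin (w M * t) + d M * cos (w M * t))).
  by apply: cvgD; [exact: IH|exact: cp].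
by apply/funext => u; rewrite /sincos_comb big_ord_recr.
Qed.

(** [G] sums the antiderivatives chosen for all pairs, and only the diagonal ones contribute.
    Equality makes [L] serve as both Riesz bounds. *)
Lemma sqnormI_sincos_comb M (c d : nat -> R) :
  sqnormI (- L) L (sincos_comb w M c d) =
  (L * \sum_(n < M) (c n ^+ 2 + d n ^+ 2))%:E.
Proof.
have [F HF] := choice (fun p : nat * nat =>
  product_antiderivative (c p.1) (d p.1) (c p.2) (d p.2) p.1 p.2).
pose G : R -> R := \sum_(i < M) \sum_(j < M) F (i : nat, j : nat).
have dG (t : R) : is_derive t (1 : R) G (sincos_comb w M c d t ^+ 2).
  rewrite expr2 /sincos_comb big_distrl/=.
  apply: is_derive_sum => i; rewrite big_distrr/=.
  by apply: is_derive_sum => j; exact: (HF (i : nat, j : nat)).1.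
have GE t : G t = \sum_(i < M) \sum_(j < M) F (i : nat, j : nat) t.
  by rewrite /G fct_sumE; apply: eq_bigr => i _; rewrite fct_sumE.
rewrite /sqnormI (@integral_FTC R (fun t => sincos_comb w M c d t ^+ 2) G).
- congr EFin; rewrite !GE -sumrB big_distrr/=; apply: eq_bigr => i _.
  rewrite -sumrB (bigD1 i)//= (HF (i : nat, i : nat)).2 eqxx big1 ?addr0.
    by rewrite !expr2.
  move=> j ji; rewrite (HF (i : nat, j : nat)).2/= ifN// eq_sym.
  by rewrite -val_eqE in ji.
- by apply: (@le_trans _ _ 0); rewrite ?oppr_le0 ltW.
- move=> t _; apply: (@continuous_comp _ _ _ _ (fun y : R => y ^+ 2)).
    exact: continuous_sincos_comb.
  exact: exprn_continuous.
- move=> t _; have [dt _] := dG t.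
  by apply: differentiable_continuous; exact/derivable1_diffP.
Qed.

End orthogonality.

(** * Completeness in L^2 *)

Section density.
Context {R : realType}.
Local Notation mu := (@lebesgue_measure R).
Variable L : R.
Hypothesis L0 : 0 < L.
Local Notation w := (half_freq L).
Local Notation I := (`[- L, L]%classic : set R).

Definition approximable (f : R -> R) := measurable_fun I f /\
  forall eps : R, 0 < eps -> exists2 u, is_comb L u &
    (sqnormI (- L) L (fun t => (f t - u t)%R) < eps%:E)%E.

Let mI : measurable I.
Proof. exact: measurable_itv. Qed.

(** The pointwise bound [(f + g) ^+ 2 <= 2 * f ^+ 2 + 2 * g ^+ 2] stands in for the triangle
    inequality, whence the [eps / 4] below. *)
Lemma sqnormID (f g : R -> R) : measurable_fun I f -> measurable_fun I g ->
  (sqnormI (- L) L (fun t => (f t + g t)%R) <=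
   2%:E * sqnormI (- L) L f + 2%:E * sqnormI (- L) L g)%E.
Proof.
move=> mf mg.
have msq (h : R -> R) : measurable_fun I h ->
    measurable_fun I (fun t => (h t ^+ 2)%:E).
  by move=> mh; apply/measurable_EFinP; exact: measurable_funX.
have sq0 (h : R -> R) t : (0 <= (h t ^+ 2)%:E)%E by rewrite lee_fin sqr_ge0.
rewrite /sqnormI -!ge0_integralZl_EFin//; try exact: msq.
rewrite -ge0_integralD//; first last.
- by apply: measurable_funeM; exact: msq.
- by move=> t _; rewrite mule_ge0.
- by apply: measurable_funeM; exact: msq.
- by move=> t _; rewrite mule_ge0.
apply: ge0_le_integral => //.
- by apply: msq; exact: measurable_funD.
- by apply: emeasurable_funD; apply: measurable_funeM; exact: msq.
move=> t _; rewrite -!EFinM -EFinD lee_fin.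
by have := sqr_ge0 (f t - g t); nra.
Qed.

Lemma is_comb_measurable u : is_comb L u -> measurable_fun I u.
Proof.
move=> [M [c [d ->]]]; apply: measurable_funTS.
by apply: continuous_measurable_fun; exact: continuous_sincos_comb.
Qed.

Lemma approximable_comb u : is_comb L u -> approximable u.
Proof.
move=> cu; split; first exact: is_comb_measurable.
move=> eps e0; exists u => //; rewrite /sqnormI.
by rewrite integral0_eq ?lte_fin// => t _; rewrite subrr expr0n.
Qed.

Lemma approximableD f g : approximable f -> approximable g ->
  approximable (fun t => f t + g t).
Proof.
move=> [mf af] [mg ag]; split; first exact: measurable_funD.
move=> eps e0; have e4 : 0 < eps / 4 by lra.
have [u cu fu] := af _ e4; have [v cv gv] := ag _ e4.
exists (fun t => u t + v t); first exact: is_combD.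
have -> : (fun t => f t + g t - (u t + v t)) =
    (fun t => (f t - u t) + (g t - v t)) by apply/funext => t; ring.
apply: (le_lt_trans (sqnormID _ _)).
- by apply: measurable_funB => //; exact: is_comb_measurable.
- by apply: measurable_funB => //; exact: is_comb_measurable.
have -> : eps%:E = (2%:E * (eps / 4)%:E + 2%:E * (eps / 4)%:E)%E.
  by rewrite -!EFinM -EFinD; congr EFin; field.
by apply: lteD; rewrite lte_pmul2l.
Qed.

Lemma approximableZ (a : R) f : approximable f -> approximable (fun t => a * f t).
Proof.
move=> [mf af]; split.
  by apply: measurable_funM => //; exact: measurable_cst.
(* Dividing by [a ^+ 2 + 1] rather than [a ^+ 2] covers [a = 0]. *)
move=> eps e0; have a1 : 0 < a ^+ 2 + 1 by rewrite ltr_wpDl ?sqr_ge0.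
have [u cu fu] := af (eps / (a ^+ 2 + 1)) (divr_gt0 e0 a1).
exists (fun t => a * u t); first exact: is_combZ.
have mfu : measurable_fun I (fun t => ((f t - u t) ^+ 2)%:E).
  apply/measurable_EFinP; apply: measurable_funX.
  by apply: measurable_funB => //; exact: is_comb_measurable.
apply: (@le_lt_trans _ _ ((a ^+ 2 + 1)%:E *
    sqnormI (- L) L (fun t => (f t - u t)%R))%E); last first.
  have -> : eps%:E = ((a ^+ 2 + 1)%:E * (eps / (a ^+ 2 + 1))%:E)%E.
    by rewrite -EFinM; congr EFin; field; rewrite gt_eqF.
  by rewrite lte_pmul2l ?lte_fin.
rewrite /sqnormI -ge0_integralZl_EFin//; last exact: ltW.
  apply: ge0_le_integral => //.
  - by move=> t _; rewrite lee_fin sqr_ge0.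
  - apply/measurable_EFinP; apply: measurable_funX.
    have -> : (fun t => a * f t - a * u t) = (fun t => a * (f t - u t)).
      by apply/funext => t; ring.
    apply: measurable_funM; first exact: measurable_cst.
    by apply: measurable_funB => //; exact: is_comb_measurable.
  - exact: measurable_funeM.
  move=> t _; rewrite -EFinM lee_fin -mulrBr exprMn ler_wpM2r ?sqr_ge0//.
  by rewrite lerDl.
by move=> t _; rewrite lee_fin sqr_ge0.
Qed.

(** The bound by [h] passes to the limit [f], so [(f - g n) ^+ 2 <= 4 * h ^+ 2] and dominated
    convergence applies; a good [g n] is then itself approximated. *)
Lemma approximable_lim (g : nat -> R -> R) (f h : R -> R) :
  (forall n, approximable (g n)) -> measurable_fun I f -> measurable_fun I h ->
  (sqnormI (- L) L h < +oo)%E ->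
  (forall n t, I t -> `|g n t| <= h t) ->
  {ae mu, forall t, I t -> g n t @[n --> \oo] --> f t} ->
  approximable f.
Proof.
move=> ag mf mh hoo gh gf; split=> // eps e0.
have Fae := ae_filter_ringOfSetsType mu.
have cv : (fun n => sqnormI (- L) L (fun t => (f t - g n t)%R)) @ \oo --> 0%E.
  have [||||| _ _ H] := @dominated_convergence _ _ _ mu I mI
    (fun n t => ((f t - g n t) ^+ 2)%:E) (cst 0%E)
    (fun t => (4 * h t ^+ 2)%:E).
  - move=> n; apply/measurable_EFinP; apply: measurable_funX.
    by apply: measurable_funB => //; exact: (ag n).1.
  - exact: measurable_cst.
  - apply: filterS gf => t H It; apply: cvg_EFin; first exact: nearW.
    rewrite /= -[X in _ --> X](_ : (f t - f t) ^+ 2 = _); last first.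
      by rewrite subrr expr0n.
    apply: (@cvg_comp _ _ _ (fun n => f t - g n t) (fun y : R => y ^+ 2)).
      by apply: cvgB; [exact: cvg_cst|exact: H].
    exact: exprn_continuous.
  - have mh2 : measurable_fun I (fun t => (h t ^+ 2)%:E).
      by apply/measurable_EFinP; exact: measurable_funX.
    rewrite (_ : (fun t => _) = (fun t => 4%:E * (h t ^+ 2)%:E)%E); last first.
      by apply/funext => t; rewrite EFinM.
    apply: integrableZl => //; apply/integrableP; split=> //.
    rewrite (_ : integral _ _ _ = sqnormI (- L) L h)//.
    apply: eq_integral => t _; rewrite gee0_abs//.
    by rewrite lee_fin sqr_ge0.
  - apply: filterS gf => t H n It; rewrite lee_fin normrX.
    have {}H := H It.
    have fh : `|f t| <= h t.
      have cvn : `|g n t| @[n --> \oo] --> `|f t| by apply: cvg_norm.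
      rewrite -(cvg_lim _ cvn)//; apply: limr_le; first exact: cvgP cvn.
      by apply: nearW => m; exact: gh.
    have gn := gh n t It; have := ler_normB (f t) (g n t).
    have := normr_ge0 (f t - g n t); nra.
  - by move: H; rewrite integral0.
have e4 : 0 < eps / 4 by lra.
have [n ng] : exists n, (sqnormI (- L) L (fun t => (f t - g n t)%R) < (eps / 4)%:E)%E.
  have [N _ HN] : \forall n \near \oo,
      (sqnormI (- L) L (fun t => (f t - g n t)%R) < (eps / 4)%:E)%E.
    by apply: (cv [set x | (x < (eps / 4)%:E)%E]); by apply: open_ereal_lt'; rewrite lte_fin.
  by exists N; exact: (HN N (leqnn N)).
have [mgn agn] := ag n; have [u cu gu] := agn _ e4.
exists u => //.
have -> : (fun t => f t - u t) = (fun t => (f t - g n t) + (g n t - u t)).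
  by apply/funext => t; ring.
apply: (le_lt_trans (sqnormID _ _)).
- exact: measurable_funB.
- by apply: measurable_funB => //; exact: is_comb_measurable.
have -> : eps%:E = (2%:E * (eps / 4)%:E + 2%:E * (eps / 4)%:E)%E.
  by rewrite -!EFinM -EFinD; congr EFin; field.
by apply: lteD; rewrite lte_pmul2l.
Qed.

Lemma approximable_sum N (g : nat -> R -> R) : (forall i, (i < N)%N -> approximable (g i)) ->
  approximable (fun t => \sum_(i < N) g i t).
Proof.
elim: N => [_|N IH ag].
  rewrite (_ : (fun t => _) = fun _ => 0).
    by apply: approximable_comb; exact: is_comb0.
  by apply/funext => t; rewrite big_ord0.
rewrite (_ : (fun t => _) = fun t => \sum_(i < N) g i t + g N t).
  by apply: approximableD; [apply: IH => i iN; apply: ag; exact: ltnW|exact: ag].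
by apply/funext => t; rewrite big_ord_recr.
Qed.

Lemma sqnormI_cst_lty (c : R) : (sqnormI (- L) L (fun _ => c) < +oo)%E.
Proof.
rewrite /sqnormI integral_cst//= lebesgue_measure_itv/= lte_fin.
by rewrite gtrN// -EFinD -EFinM ltry.
Qed.

(** The step is half the difference of the signs of [t + L] and [t - al]: the first sign is 1 inside
    the interval and supplies the constant. Values of [f] at the endpoints and at [al] are left
    free. *)
Lemma approximable_step (al : R) (f : R -> R) : - L <= al <= L ->
  measurable_fun I f ->
  (forall t, - L < t < L -> t != al -> f t = (t < al)%R%:R) -> approximable f.
Proof.
move=> /andP[al1 al2] mf fE.
have pi0 := pi_gt0 R.
pose q n t : R := 2^-1 * (sign_iter n (half_sin L (- L) t) -
                          sign_iter n (half_sin L al t)).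
have hs1 b t : `|half_sin L b t| <= 1 by rewrite ler_norml sin_geN1 sin_le1.
have hs_pos b t : b < t < b + 2 * L -> 0 < half_sin L b t <= 1.
  move=> /andP[bt tb]; rewrite sin_le1 andbT; apply: sin_gt0_pi.
  apply/andP; split; first by rewrite !mulr_gt0 ?invr_gt0 ?mulr_gt0// subr_gt0.
  have L2 : 0 < 2 * L by rewrite mulr_gt0.
  rewrite mulrAC ltr_pdivrMr// ltr_pM2l//.
  by rewrite ltrBlDl.
have hs_neg b t : b - 2 * L < t < b -> -1 <= half_sin L b t < 0.
  move=> /andP[bt tb]; have : 0 < half_sin L t b <= 1.
    by apply: hs_pos; rewrite tb/= -ltrBlDr.
  have -> : half_sin L t b = - half_sin L b t.
    by rewrite /half_sin -sinN -mulrN opprB.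
  lra.
apply: (@approximable_lim q f (fun _ => 1)) => //.
- move=> n; apply: approximable_comb; rewrite /q.
  have -> : (fun t => 2^-1 * (sign_iter n (half_sin L (- L) t) -
      sign_iter n (half_sin L al t))) =
      (fun t => 2^-1 * (sign_iter n (half_sin L (- L) t) +
      - 1 * sign_iter n (half_sin L al t))).
    by apply/funext => t; rewrite mulN1r.
  apply: is_combZ; apply: is_combD; first exact: is_comb_poly.
  by apply: is_combZ; exact: is_comb_poly.
- exact: sqnormI_cst_lty.
- move=> n t _; rewrite /q normrM gtr0_norm//.
  have h1 := norm_sign_iter_le1 n (hs1 (- L) t).
  have h2 := norm_sign_iter_le1 n (hs1 al t).
  have := ler_normB (sign_iter n (half_sin L (- L) t)) (sign_iter n (half_sin L al t)).
  lra.
(* At each of these points one of the two sines vanishes. *)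
exists [set (- L); al; L]; split.
- by apply: measurableU; [apply: measurableU|]; exact: measurable_set1.
- by apply: countable_lebesgue_measure0; apply: finite_set_countable; rewrite !finite_setU.
move=> t /=; apply: contra_notP => tN; rewrite /= in_itv/= => /andP[t1 t2].
have {}t1 : - L < t.
  by rewrite lt_neqAle t1 andbT; apply/eqP => tL; apply: tN; left; left.
have {}t2 : t < L.
  by rewrite lt_neqAle t2 andbT; apply/eqP => tL; apply: tN; right.
have ta : t != al by apply/eqP => tal; apply: tN; left; right.
rewrite fE ?t1// /q.
have c1 : sign_iter n (half_sin L (- L) t) @[n --> \oo] --> (1 : R).
  by apply: sign_iter_cvg1; apply: hs_pos; lra.
have [tal|tal|tal] := ltgtP t al; last by rewrite tal eqxx in ta.
- have c2 : sign_iter n (half_sin L al t) @[n --> \oo] --> (- 1 : R).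
    by apply: sign_iter_cvgN1; apply: hs_neg; lra.
  rewrite -[X in _ --> X](_ : 2^-1 * (1 - -1) = _); last by rewrite /=; field.
  by apply: cvgM; [exact: cvg_cst|exact: cvgB].
- have c2 : sign_iter n (half_sin L al t) @[n --> \oo] --> (1 : R).
    by apply: sign_iter_cvg1; apply: hs_pos; lra.
  rewrite -[X in _ --> X](_ : 2^-1 * (1 - 1) = _); last by rewrite subrr mulr0.
  by apply: cvgM; [exact: cvg_cst|exact: cvgB].
Qed.

Lemma approximable_indic (A : set (measurableTypeR R)) : measurable A ->
  approximable (\1_A : R -> R).
Proof.
pose H := [set A : set (measurableTypeR R) |
  measurable A /\ approximable (\1_A : R -> R)].
have step (x : R) (f : R -> R) : measurable_fun I f ->
    (forall t, - L < t < L -> t != x -> f t = (t < x)%R%:R) -> approximable f.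
  move=> mf fE; have LL : - L <= L by rewrite ge0_cp// ltW.
  (* Clamping the threshold to the interval also covers the rays that contain or miss it
     entirely. *)
  pose al := Num.max (- L) (Num.min x L).
  apply: (@approximable_step al) => //.
    by rewrite /al le_max lexx/= ge_max LL ge_min lexx orbT.
  move=> t /[dup] /andP[t1 t2] tL ta; have [tx|tx] := eqVneq t x.
    by exfalso; move/eqP: ta; apply; rewrite /al -tx min_l ?max_r ?ltW.
  by rewrite fE// /al lt_max lt_min t2 andbT ltNge (ltW t1).
have HG : @RGenInftyO.G R `<=` H.
  move=> _ [x ->]; split; first exact: measurable_itv.
  apply: (step x); first by apply: measurable_funTS; exact: measurable_indic.
  move=> t _ _; rewrite indicE; congr (_%:R).
  by congr nat_of_bool; apply/idP/idP => [/set_mem|tx]; [|apply/mem_set]; rewrite /= in_itv.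
have HL : lambda_system setT H.
  split => //.
  - split; first exact: measurableT.
    (* Inside the interval the whole line looks like the ray ending at [L]. *)
    apply: (step L); first by apply: measurable_funTS; exact: measurable_indic.
    by move=> t /andP[_ tL] _; rewrite indicT tL.
  - move=> B C CB [mB aB] [mC aC]; split; first exact: measurableD.
    rewrite (_ : \1_(B `\` C) = fun t => \1_B t + - 1 * \1_C t).
      by apply: approximableD => //; exact: approximableZ.
    apply/funext => t; rewrite !indicE in_setD.
    have [tC|tC] /= := boolP (t \in C); last by rewrite andbT mulr0 addr0.
    by rewrite andbF mem_set ?mulr1 ?subrr//; apply: CB; exact: set_mem.
  - move=> F ndF HF; have mF n : measurable (F n) by case: (HF n).
    have mU : measurable (\bigcup_n F n) by exact: bigcupT_measurable.
    split=> //.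
    apply: (@approximable_lim (fun n => \1_(F n)) _ (fun _ => 1)) => //.
    + by move=> n; case: (HF n).
    + exact: sqnormI_cst_lty.
    + by move=> n t _; rewrite indicE; case: (t \in _); rewrite ?normr1 ?normr0.
    apply: aeW => t _; rewrite indicE.
    have [/set_mem[N _ FNt]|tF] := boolP (t \in _).
      apply: cvg_near_cst; exists N => // n /= Nn; rewrite indicE mem_set//.
      by apply: (subsetPset _ _ (ndF _ _ Nn)).
    apply: cvg_near_cst; apply: nearW => n; rewrite indicE.
    rewrite memNset// => Ft; move/negP: tF; apply; apply/mem_set.
    by exists n.
move=> mA; suff : H A by case.
apply: (@lambda_system_subset _ (@RGenInftyO.G R) _ setT H HL HG) => //.
  move=> _ _ [x ->] [y ->]; exists (Num.min x y).
  by apply/seteqP; split=> t /=; rewrite !in_itv/= lt_min => /andP.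
by move: mA; rewrite -[measurable]/(@ocitv R).-sigma.-measurable RGenInftyO.measurableE.
Qed.

Import HBNNSimple.

(** Simple functions increase to [f], so [f] itself is the dominating function. *)
Lemma approximable_ge0 (f : R -> R) : measurable_fun I f ->
  (forall t, I t -> 0 <= f t) -> (sqnormI (- L) L f < +oo)%E -> approximable f.
Proof.
move=> mf f0 foo.
have mEf : measurable_fun I (EFin \o f) by exact/measurable_EFinP.
pose g := nnsfun_approx mI mEf.
have gf t : I t -> g n t @[n --> \oo] --> f t.
  move=> It; have f0E x : I x -> (0 <= (EFin \o f) x)%E.
    by move=> Ix; rewrite lee_fin f0.
  exact: (fine_cvg (cvg_nnsfun_approx mI mEf f0E It)).
have nd t : nondecreasing_seq (fun n => g n t).
  by move=> m n mn; have /lefP := nd_nnsfun_approx mI mEf mn; exact.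
apply: (@approximable_lim (fun n => g n) f f) => //.
- move=> n; set s := fset_set (range (g n)).
  rewrite (_ : (g n : R -> R) = fun x => \sum_(i < #|` s|)
      (s`_i * \1_(g n @^-1` [set s`_i]) x)); last first.
    by apply/funext => x; rewrite fimfunEord.
  apply: (@approximable_sum _ (fun i x => s`_i * \1_(g n @^-1` [set s`_i]) x)).
  move=> i _; apply: approximableZ; apply: approximable_indic.
  rewrite -[X in measurable X]setTI.
  by apply: (measurable_funP (g n)) => //; exact: measurable_set1.
- move=> n t It; rewrite ger0_norm; last exact: fun_ge0.
  rewrite -(cvg_lim _ (gf t It))//.
  by apply: nondecreasing_cvgn_le => //; apply: cvgP; exact: gf.
by apply: aeW.
Qed.

Lemma approximable_L2 (f : R -> R) : L2on mu I f -> approximable f.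
Proof.
move=> [mf foo].
have part (g : R -> R) : measurable_fun I g -> (sqnormI (- L) L g < +oo)%E ->
    approximable (fun t => Num.max (g t) 0).
  move=> mg goo; have mg0 : measurable_fun I (fun t => Num.max (g t) 0).
    by apply: measurable_maxr => //; exact: measurable_cst.
  apply: approximable_ge0 => //.
    by move=> t _; rewrite le_max lexx orbT.
  apply: le_lt_trans goo; apply: ge0_le_integral => //.
  - by move=> t _; rewrite lee_fin sqr_ge0.
  - by apply/measurable_EFinP; exact: measurable_funX.
  - by apply/measurable_EFinP; exact: measurable_funX.
  move=> t _; rewrite lee_fin; case: (leP (g t) 0) => // _.
  by rewrite expr0n sqr_ge0.
rewrite (_ : f = fun t => Num.max (f t) 0 + - 1 * Num.max (- f t) 0).
  apply: approximableD; first exact: part.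
  apply: approximableZ; apply: (part (fun t => - f t)).
    exact: measurable_funN.
  by rewrite /sqnormI; under eq_integral do rewrite sqrrN.
apply/funext => t; case: (leP (f t) 0) => ft.
  by rewrite max_l ?oppr_ge0//; ring.
by rewrite max_r ?oppr_le0 ?ltW//; ring.
Qed.

Lemma sincos_riesz_basis_half_freq : sincos_riesz_basis w (- L) L.
Proof.
split.
  move=> f /approximable_L2[_ af] eps e0; have [_ [M [c [d ->]]] H] := af _ e0.
  by exists M, c, d.
exists L, L; split=> // M c d.
by rewrite /= (sqnormI_sincos_comb L0).
Qed.

End density.

Theorem theorem1p2 (R : realType) (z : R3 R) (a c1 : R) (lam : nat -> R) :
  0 < a -> 0 < c1 ->
  (forall m n : nat, (m < n)%N -> lam n < lam m) ->
  range lam = [set l | mean_eigenvalue (ball3 z a) l] ->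
  let omega := fun n => c1 / Num.sqrt (lam n) in
  let b := c1 * pi / a in
  sincos_riesz_basis omega (- (pi / b)) (pi / b).
Proof.
move=> a0 c0 dlam rlam omega b; have pi0 := pi_gt0 R.
have L0 : 0 < pi / b by rewrite !divr_gt0 ?mulr_gt0.
(* Here [pi / b = a / c1], so [c1 * ((n + 1/2) * pi / a)] is the half-odd multiple of [pi] over this
   half-length. *)
have -> : omega = half_freq (pi / b).
  apply/funext => n; rewrite /omega (mean_eigenvalues_enum a0 dlam rlam).
  have k0 : 0 < (n%:R + 2^-1) * pi / a.
    by rewrite divr_gt0// mulr_gt0// ltr_wpDl.
  rewrite -exprVn sqrtr_sqr ger0_norm ?invr_ge0 ?(ltW k0)// invrK.
  rewrite /half_freq /b; move: (pi : R) pi0 => p p0.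
  by field; rewrite !gt_eqF.
exact: sincos_riesz_basis_half_freq.
Qed.
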